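(* Let $r\in\Sigma$ and let $M$ be a convex exponential set in $\Sigma$. Then there exists $p\in M$ such that $dist(r,M)=dist(r,p)$ if and only if there is a geodesic through $r$ orthogonal to $M$.
   Context: ${\cal A}$ is a von Neumann algebra with a finite, normal, faithful tracial state $\tau$; ${\cal A}_h$ is the real space of selfadjoint elements; $\Sigma=e^{{\cal A}_h}$ is the set of positive invertible elements of ${\cal A}$, an open subset of ${\cal A}_h$ in the operator norm, with tangent space ${\cal A}_h$ at each point. For $a\in\Sigma$, $x,y\in{\cal A}_h$ put $\langle x,y\rangle_a=\tau(xa^{-1}ya^{-1})$, $\|x\|_a=\langle x,x\rangle_a^{1/2}$. A smooth curve is a continuously differentiable (for the operator norm) curve $\gamma:[0,1]\to\Sigma$, $Length(\gamma)=\int_0^1\|\dot\gamma(t)\|_{\gamma(t)}\,dt$, $dist(a,b)$ is the infimum of lengths of smooth curves in $\Sigma$ joining $a$ and $b$, and $dist(r,M)=\inf_{q\in M}dist(r,q)$. For $p,q\in\Sigma$ the geodesic joining $p$ to $q$ is $\delta_{p,q}(t)=p^{1/2}(p^{-1/2}qp^{-1/2})^tp^{1/2}$, and ${\rm Exp}_p(v)=p^{1/2}e^{p^{-1/2}vp^{-1/2}}p^{1/2}$ for $v\in{\cal A}_h$. A subset $M\subset\Sigma$ is convex if $\delta_{p,q}(t)\in M$ for all $p,q\in M$ and all real $t$. An exponential set is $M=e^H$ with $H$ a norm closed real subspace of ${\cal A}_h$. For a convex exponential set $M=e^H$ and $p\in M$, $T_pM=p^{1/2}Hp^{1/2}$.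 ''There is a geodesic through $r$ orthogonal to $M$'' means: there are $p\in M$ and $v\in{\cal A}_h$ with $\langle v,w\rangle_p=0$ for all $w\in T_pM$ and ${\rm Exp}_p(v)=r$ ($v=0$ being allowed, when $r=p\in M$). *)

(* Defs.v *)
From HB Require Import structures.
From mathcomp Require Import all_boot all_order all_algebra.
From mathcomp Require Import complex.
From mathcomp Require Import all_classical all_reals all_analysis.
Import Order.TTheory GRing.Theory Num.Theory.
Import numFieldNormedType.Exports.

Set Implicit Arguments.
Unset Strict Implicit.
Unset Printing Implicit Defensive.

Local Open Scope complex_scope.
Local Open Scope classical_set_scope.
Local Open Scope ring_scope.

(* The real algebra B(H) of bounded complex-linear operators on H.  Only real  *)
(* scalars act through the module structure, so that B(H) is a real normed     *)
(* space in which curves can be differentiated; complex scalars act through    *)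
(* cscale below.  B(H) is a possibly trivial ring (pzRingType), as H = 0 is    *)
(* not excluded.                                                               *)

Definition op_bound (R : realType) (H : completeNormedModType R[i])
    (f : H -> H) (c : R) :=
  forall u, `|f u| <= c%:C * `|u|.

Record bop (R : realType) (H : completeNormedModType R[i]) := Bop {
  bop_fun :> H -> H;
  bop_linear : linear bop_fun;
  bop_bounded : exists c : R, op_bound bop_fun c
}.

Section BoundedOperators.
Variables (R : realType) (H : completeNormedModType R[i]).
Implicit Types (x y z : bop H) (u v : H).

Let realcM (a b : R) : (a * b)%:C = a%:C * b%:C.
Proof. exact: rmorphM. Qed.

Let realcD (a b : R) : (a + b)%:C = a%:C + b%:C.
Proof. exact: rmorphD. Qed.

Lemma bop_ext x y : (forall u, x u = y u) -> x = y.
Proof.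
case: x y => [f lf bf] [g lg bg] /= /funext fg; subst g.
by congr Bop; exact: Prop_irrelevance.
Qed.

HB.instance Definition _ := gen_eqMixin (bop H).
HB.instance Definition _ := gen_choiceMixin (bop H).

Lemma bopD x u v : x (u + v) = x u + x v.
Proof. by have := bop_linear x 1 u v; rewrite !scale1r. Qed.

Lemma bop0 x : x 0 = 0.
Proof. by have := bopD x 0 0; rewrite addr0 -[LHS]addr0 => /addrI. Qed.

Lemma bopZ x (a : R[i]) u : x (a *: u) = a *: x u.
Proof. by have := bop_linear x a u 0; rewrite bop0 !addr0. Qed.

Lemma bop_bound_ge0 x : exists2 c : R, 0 <= c & op_bound x c.
Proof.
have [c xc] := bop_bounded x; exists (Num.max c 0).
  by rewrite le_max lexx orbT.
move=> u; apply: (le_trans (xc u)); apply: ler_wpM2r => //.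
by rewrite lecR le_max lexx.
Qed.

Fact zero_linear : linear (fun _ : H => 0 : H).
Proof. by move=> a u v; rewrite scaler0 addr0. Qed.
Fact zero_bounded : exists c : R, op_bound (fun _ : H => 0 : H) c.
Proof. by exists 0 => u; rewrite mul0r normr0. Qed.
Definition bop_zero := Bop zero_linear zero_bounded.

Fact one_linear : linear (fun u : H => u).
Proof. by []. Qed.
Fact one_bounded : exists c : R, op_bound (fun u : H => u) c.
Proof. by exists 1 => u; rewrite mul1r. Qed.
Definition bop_one := Bop one_linear one_bounded.

Fact add_linear x y : linear (fun u => x u + y u).
Proof.
by move=> a u v; rewrite !bopD !bopZ scalerDr !addrA; congr (_ + _);
  rewrite -!addrA; congr (_ + _); rewrite addrC.
Qed.
Fact add_bounded x y : exists c : R, op_bound (fun u => x u + y u) c.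
Proof.
have [c _ xc] := bop_bound_ge0 x; have [d _ yd] := bop_bound_ge0 y.
exists (c + d) => u; apply: (le_trans (ler_normD _ _)).
by rewrite realcD mulrDl lerD.
Qed.
Definition bop_add x y := Bop (@add_linear x y) (@add_bounded x y).

Fact cscale_linear (a : R[i]) x : linear (fun u => a *: x u).
Proof.
by move=> b u v; rewrite bopD bopZ scalerDr !scalerA mulrC.
Qed.
Fact cscale_bounded (a : R[i]) x : exists c : R, op_bound (fun u => a *: x u) c.
Proof.
have [c _ xc] := bop_bound_ge0 x.
exists (complex.Re `|a| * c) => u; rewrite normrZ realcM -mulrA.
by rewrite RRe_real ?normr_real// ler_wpM2l.
Qed.
Definition cscale (a : R[i]) x := Bop (cscale_linear a x) (cscale_bounded a x).

Fact mul_linear x y : linear (fun u => x (y u)).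
Proof. by move=> a u v; rewrite !bopD !bopZ. Qed.
Fact mul_bounded x y : exists c : R, op_bound (fun u => x (y u)) c.
Proof.
have [c c0 xc] := bop_bound_ge0 x; have [d _ yd] := bop_bound_ge0 y.
exists (c * d) => u; apply: (le_trans (xc _)).
by rewrite realcM -mulrA ler_wpM2l// lecR.
Qed.
Definition bop_mul x y := Bop (@mul_linear x y) (@mul_bounded x y).

Fact bop_addA : associative bop_add.
Proof. by move=> x y z; apply: bop_ext => u /=; rewrite addrA. Qed.
Fact bop_addC : commutative bop_add.
Proof. by move=> x y; apply: bop_ext => u /=; rewrite addrC. Qed.
Fact bop_add0 : left_id bop_zero bop_add.
Proof. by move=> x; apply: bop_ext => u /=; rewrite add0r. Qed.
Fact bop_addN : left_inverse bop_zero (cscale (-1)) bop_add.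
Proof. by move=> x; apply: bop_ext => u /=; rewrite scaleN1r addNr. Qed.

HB.instance Definition _ :=
  GRing.isZmodule.Build (bop H) bop_addA bop_addC bop_add0 bop_addN.

Lemma bop_addE x y u : (x + y) u = x u + y u. Proof. by []. Qed.

Fact bop_mulA : associative bop_mul.
Proof. by move=> x y z; apply: bop_ext. Qed.
Fact bop_mul1 : left_id bop_one bop_mul.
Proof. by move=> x; apply: bop_ext. Qed.
Fact bop_mulr1 : right_id bop_one bop_mul.
Proof. by move=> x; apply: bop_ext. Qed.
Fact bop_mulDl : left_distributive bop_mul +%R.
Proof. by move=> x y z; apply: bop_ext. Qed.
Fact bop_mulDr : right_distributive bop_mul +%R.
Proof. by move=> x y z; apply: bop_ext => u; rewrite /= bopD. Qed.

HB.instance Definition _ := GRing.Zmodule_isPzRing.Build (bop H)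
  bop_mulA bop_mul1 bop_mulr1 bop_mulDl bop_mulDr.

Definition bop_scale (a : R) x := cscale a%:C x.

Fact bop_scaleA (a b : R) x :
  bop_scale a (bop_scale b x) = bop_scale (a * b) x.
Proof. by apply: bop_ext => u /=; rewrite scalerA realcM. Qed.
Fact bop_scale1 : left_id 1 bop_scale.
Proof. by move=> x; apply: bop_ext => u /=; rewrite scale1r. Qed.
Fact bop_scaleDr : right_distributive bop_scale +%R.
Proof. by move=> a x y; apply: bop_ext => u /=; rewrite scalerDr. Qed.
Fact bop_scaleDl x : {morph bop_scale^~ x : a b / a + b}.
Proof. by move=> a b; apply: bop_ext => u /=; rewrite realcD scalerDl. Qed.

HB.instance Definition _ := GRing.Zmodule_isLmodule.Build R (bop H)
  bop_scaleA bop_scale1 bop_scaleDr bop_scaleDl.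

Definition opnorm x : R := inf [set c : R | 0 <= c /\ op_bound x c].

Lemma has_inf_opnorm x : has_inf [set c : R | 0 <= c /\ op_bound x c].
Proof.
split; first by have [c c0 xc] := bop_bound_ge0 x; exists c.
by exists 0 => c [].
Qed.

Lemma opnorm_ge0 x : 0 <= opnorm x.
Proof. by apply: lb_le_inf; [have [] := has_inf_opnorm x|move=> c []]. Qed.

Lemma opnorm_le x (c : R) : 0 <= c -> op_bound x c -> opnorm x <= c.
Proof. by move=> c0 xc; apply: ge_inf => //; have [] := has_inf_opnorm x. Qed.

Lemma opnormP x : op_bound x (opnorm x).
Proof.
move=> u; have [->|u0] := eqVneq u 0; first by rewrite bop0 !normr0 mulr0.
have nE v : `|v| = (complex.Re `|v|)%:C by rewrite RRe_real ?normr_real.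
have nu : 0 < complex.Re `|u| by rewrite -ltcR -nE normr_gt0.
rewrite (nE u) (nE (x u)) -realcM lecR -ler_pdivrMr//.
apply: lb_le_inf; first by have [] := has_inf_opnorm x.
move=> c [c0 /(_ u)]; rewrite ler_pdivrMr//.
by rewrite (nE u) (nE (x u)) -realcM lecR.
Qed.

Fact opnormD x y : opnorm (x + y) <= opnorm x + opnorm y.
Proof.
apply: opnorm_le; first by rewrite addr_ge0// opnorm_ge0.
move=> u; apply: (le_trans (ler_normD _ _)).
by rewrite realcD mulrDl lerD//; exact: opnormP.
Qed.

Lemma opnormZ_le (a : R) x : opnorm (a *: x) <= `|a| * opnorm x.
Proof.
apply: opnorm_le; first by rewrite mulr_ge0// opnorm_ge0.
move=> u; rewrite /= normrZ realcM -mulrA.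
have -> : `|a%:C| = `|a|%:C.
  by rewrite normc_def /= expr0n addr0 sqrtr_sqr.
by rewrite ler_wpM2l ?lecR//; exact: opnormP.
Qed.

Fact opnormZ (a : R) x : opnorm (a *: x) = `|a| * opnorm x.
Proof.
apply/eqP; rewrite eq_le opnormZ_le/=.
have [->|a0] := eqVneq a 0; first by rewrite normr0 mul0r opnorm_ge0.
rewrite -ler_pdivlMl ?normr_gt0// -normfV.
by rewrite -[X in opnorm X <= _](scalerK a0) opnormZ_le.
Qed.

Fact opnorm_eq0 x : opnorm x = 0 -> x = 0.
Proof.
move=> x0; apply: bop_ext => u; apply/eqP; rewrite -normr_le0.
by have := opnormP x u; rewrite x0 mul0r.
Qed.

HB.instance Definition _ := Lmodule_isNormed.Build R (bop H)
  opnormD opnormZ opnorm_eq0.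

End BoundedOperators.

Section VonNeumann.
Variables (R : realType) (H : completeNormedModType R[i]).
Variable form : {dot H for @Num.conj R[i]}.
Implicit Types (x y a p q v w : bop H) (A W M : set (bop H)).

Definition hilbert_form := forall u : H, `|u| ^+ 2 = form u u.

(* y = x^*.  A relation rather than a function: the adjoint of a bounded      *)
(* operator exists and is unique by the Riesz representation theorem.          *)
Definition adjoint_of x y := forall u v : H, form (x u) v = form u (y v).

Definition selfadjoint x := adjoint_of x x.

Definition op_ge0 x := forall u : H, 0 <= form (x u) u.
Definition op_le x y := op_ge0 (y - x).

Definition commutant A : set (bop H) :=
  [set x | forall y, A y -> x * y = y * x].

(* a von Neumann algebra on H: a selfadjoint set of operators equal to its     *)
(* bicommutant (the other algebra axioms follow from the second condition)     *)
Record von_neumann_algebra A : Prop := VonNeumannAlgebra {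
  vna_adjoint : forall x y, A x -> adjoint_of x y -> A y;
  vna_bicommutant : commutant (commutant A) = A
}.

(* A_h *)
Definition sa_part A : set (bop H) := [set x | A x /\ selfadjoint x].

Definition directed (D : set (bop H)) :=
  forall x y, D x -> D y -> exists z, [/\ D z, op_le x z & op_le y z].

(* s is the least upper bound of D in A_h *)
Definition sa_lub A (D : set (bop H)) s :=
  [/\ sa_part A s, (forall x, D x -> op_le x s)
    & forall b, sa_part A b -> (forall x, D x -> op_le x b) -> op_le s b].

(* Values of tau outside A are irrelevant; tau (y * x) with y the adjoint of x *)
(* is tau (x^* x).  Normality is stated for upward directed sets, which        *)
(* amounts to the statement for increasing nets.                               *)
Record fn_tracial_state A (tau : bop H -> R[i]) : Prop := FnTracialState {
  tauD : forall x y, A x -> A y -> tau (x + y) = tau x + tau y;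
  tauZ : forall (c : R[i]) x, A x -> tau (cscale c x) = c * tau x;
  tau1 : tau 1 = 1;
  tau_ge0 : forall x y, A x -> adjoint_of x y -> 0 <= tau (y * x);
  tau_faithful : forall x y, A x -> adjoint_of x y -> tau (y * x) = 0 -> x = 0;
  tau_trace : forall x y, A x -> A y -> tau (x * y) = tau (y * x);
  tau_normal : forall (D : set (bop H)) s,
    D `<=` sa_part A -> D !=set0 -> directed D -> sa_lub A D s ->
    complex.Re (tau s) = sup [set complex.Re (tau x) | x in D]
}.

Definition expop x : bop H :=
  lim (series (fun n => (n`!%:R : R)^-1 *: x ^+ n) @ \oo).

(* the selfadjoint logarithm, an inverse of expop on selfadjoint operators *)
Definition logop a : bop H := xget 0 [set x | selfadjoint x /\ expop x = a].

(* a ^ t by functional calculus, for a positive invertible; a^(1/2), a^(-1/2)  *)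
(* and a^(-1) are the cases t = 1/2, -1/2, -1                                  *)
Definition powop a (t : R) : bop H := expop (t *: logop a).

Definition invop a : bop H := xget 0 [set b | a * b = 1 /\ b * a = 1].

Definition Sigma A : set (bop H) := expop @` sa_part A.

Variables (A : set (bop H)) (tau : bop H -> R[i]).

(* tau (x a^-1 y a^-1) is real when a is in Sigma and x, y are in A_h *)
Definition ip_at a x y : R :=
  complex.Re (tau (x * invop a * y * invop a)).

Definition norm_at a x : R := Num.sqrt (ip_at a x x).

Definition diff_quot (g : R -> bop H) (t s : R) : bop H :=
  (s - t)^-1 *: (g s - g t).

(* t^' within [0, 1]: the derivative is one-sided at the end points *)
Definition at01 (t : R) : set_system R := within `[0, 1]%classic t^'.

Definition velocity (g : R -> bop H) (t : R) : bop H :=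
  lim (diff_quot g t @ at01 t).

Record smooth_curve (g : R -> bop H) : Prop := SmoothCurve {
  sc_Sigma : forall t : R, 0 <= t <= 1 -> Sigma A (g t);
  sc_derivable : forall t : R, 0 <= t <= 1 -> cvg (diff_quot g t @ at01 t);
  sc_continuous : {within `[0, 1], continuous (velocity g)}
}.

Definition Length (g : R -> bop H) : R :=
  \int[lebesgue_measure]_(t in `[0, 1]) norm_at (g t) (velocity g t).

Definition dist a b : R :=
  inf [set Length g | g in [set g | [/\ smooth_curve g, g 0 = a & g 1 = b]]].

Definition dist_set a M : R := inf [set dist a q | q in M].

Definition geodesic p q (t : R) : bop H :=
  powop p (2^-1) * powop (powop p (- 2^-1) * q * powop p (- 2^-1)) t
    * powop p (2^-1).

Definition Exp p v : bop H :=
  powop p (2^-1) * expop (powop p (- 2^-1) * v * powop p (- 2^-1))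
    * powop p (2^-1).

Definition convex_subset M :=
  forall p q, M p -> M q -> forall t : R, M (geodesic p q t).

Record closed_real_subspace W : Prop := ClosedRealSubspace {
  crs_sub : W `<=` sa_part A;
  crs0 : W 0;
  crsD : forall x y, W x -> W y -> W (x + y);
  crsZ : forall (c : R) x, W x -> W (c *: x);
  crs_closed : closed W
}.

(* the tangent space at p of the exponential set expop @` W *)
Definition tangent W p : set (bop H) :=
  [set powop p (2^-1) * w * powop p (2^-1) | w in W].

Definition orthogonal_geodesic W r :=
  exists p v, [/\ (expop @` W) p, sa_part A v,
    (forall w, tangent W p w -> ip_at p v w = 0) & Exp p v = r].

End VonNeumann.

(* Main.v *)
Require Import Defs.
From HB Require Import structures.
From mathcomp Require Import all_boot all_order all_algebra.
From mathcomp Require Import complex.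
From mathcomp Require Import all_classical all_reals all_analysis.
From mathcomp Require Import ring lra.
Import Order.TTheory GRing.Theory Num.Theory.
Import numFieldNormedType.Exports.

(** Everything reduces to two comparisons between the distance of exponentials and the
    trace norm |x| = tau (x^2)^(1/2) of selfadjoint elements:

      |w - v| <= dist (exp v) (exp w)                       (norm2_sub_le_dist)
      dist (exp v) (exp w)^2 <= |v|^2 - 2 tau (v w) + K     (dist_expop_le)

    where K is the square of the operator norm of w times a constant depending on v.  Congruence by p^(-1/2) is an isometry of the metric (dist_congr), and a convex
    exponential set is stable under congruence by its elements, because p q^-1 p is a
    point of the geodesic from p to q (exponential_set_congr).  So p may be moved to 1,
    and r becomes exp v.  If v is orthogonal to W, then dist r (exp w) >= |w - v| >= |v|
    >= dist r 1 for all w in W.  Conversely, if 1 is nearest to r in M, then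
    |v|^2 <= dist r 1 ^2 <= dist r (exp (t w))^2 <= |v|^2 - 2 t tau (v w) + O(t^2) for all
    real t, and tau (v w) = 0.

    The upper bound is the length of the explicit curve
    exp (t w / 2) exp ((1 - t) v) exp (t w / 2).  The lower bound says that the logarithm
    does not expand distances.  It rests on a finite inequality between two points
    a = exp x and b = exp y,

      |y - x|^2 <= tau ((b - a) a^-1 (b - a) b^-1)          (norm2_log_le_chord)

    whose right-hand side is, as b tends to a, the squared norm of b - a at a.  The
    inequality holds because halving x and y divides the right-hand side by at least 4
    (chord_half, the positivity of one explicit square), while 4^n times its value at
    (x / 2^n, y / 2^n) tends to the left-hand side.  Along a smooth curve g it bounds the
    right derivative of |log g(t) - log g(0)| by the speed, so that integration gives the
    lower bound without differentiating the logarithm.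

    The functional calculus involved is that of exp alone.  A selfadjoint element of A
    bounded below by a positive constant is joined to 1 by a segment of such elements,
    and its logarithm is a sum of logarithms of elements near 1, each found by a
    contracting iteration (log_near1, log_bounded_below).  Square roots of such elements,
    exp (y / 2), make tau continuous for the operator norm (rtau_norm). *)

Set Implicit Arguments.
Unset Strict Implicit.
Unset Printing Implicit Defensive.
Local Open Scope complex_scope.
Local Open Scope classical_set_scope.
Local Open Scope ring_scope.

(** * The Banach algebra of bounded operators *)

Section Completeness.
Variables (R : realType) (H : completeNormedModType R[i]).
Implicit Types (x y : bop H) (u v : H).

(** The norm of H takes values in R[i]; its real part is what can be compared with
    operator norms. *)
Definition hnorm u : R := complex.Re `|u|.

Lemma hnormE u : `|u| = (hnorm u)%:C.
Proof. by rewrite /hnorm RRe_real ?normr_real. Qed.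

Lemma hnorm_ge0 u : 0 <= hnorm u.
Proof. by rewrite -lecR -hnormE normr_ge0. Qed.

Lemma hnorm_eq0 u : (hnorm u == 0) = (u == 0).
Proof. by rewrite -(inj_eq (@complexI R)) -hnormE normr_eq0. Qed.

Lemma ler_hnormD u v : hnorm (u + v) <= hnorm u + hnorm v.
Proof. by rewrite -lecR rmorphD /= -!hnormE ler_normD. Qed.

Lemma hnorm_distC u v : hnorm (u - v) = hnorm (v - u).
Proof. by rewrite /hnorm distrC. Qed.

Lemma hnorm_opp u : hnorm (- u) = hnorm u.
Proof. by rewrite /hnorm normrN. Qed.

Lemma op_boundE x (c : R) : op_bound x c <-> forall u, hnorm (x u) <= c * hnorm u.
Proof.
by split=> xc u; have := xc u; rewrite ?hnormE -?lecR rmorphM.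
Qed.

Lemma bop_norm_le x (c : R) :
  0 <= c -> (forall u, hnorm (x u) <= c * hnorm u) -> `|x| <= c.
Proof. by move=> c0 /op_boundE; exact: opnorm_le. Qed.

Lemma hnorm_bop x u : hnorm (x u) <= `|x| * hnorm u.
Proof. by have /op_boundE := @opnormP _ _ x; exact. Qed.

Lemma bop_subE x y u : (x - y) u = x u - y u.
Proof. by rewrite bop_addE /= scaleN1r. Qed.

(** A Cauchy filter of operators converges pointwise; the bound x u - y u <= e |u|
    passes to the limit in y, so the pointwise limit is linear, bounded, and a limit
    in operator norm. *)
Lemma bop_complete (F : set_system (bop H)) :
  ProperFilter F -> cauchy F -> cvg F.
Proof.
move=> FF /cauchyP Fc.
have FcE (e : R) : 0 < e -> exists x, \forall y \near F, `|x - y| < e.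
  by move=> /Fc[x xe]; exists x; move: xe; rewrite -ball_normE.
have pcv u : cvg ((fun x => x u) @ F).
  apply/cauchy_cvgP/cauchyP => e e0.
  have eR : e = (complex.Re e)%:C by rewrite RRe_real// gtr0_real.
  have e0R : 0 < complex.Re e by rewrite -ltcR -eR.
  have u1 : 0 < 1 + hnorm u by rewrite ltr_wpDr ?hnorm_ge0.
  have [d d0 de] : exists2 d : R, 0 < d & d * hnorm u < complex.Re e.
    exists (complex.Re e / (1 + hnorm u)); first by rewrite divr_gt0.
    by rewrite mulrAC ltr_pdivrMr// ltr_pM2l// ltrDr.
  have [x xd] := FcE d d0; exists (x u).
  rewrite -ball_normE /=; near=> y; rewrite /= hnormE eR ltcR -bop_subE.
  apply: le_lt_trans de; apply: le_trans (hnorm_bop _ _) _.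
  by rewrite ler_wpM2r ?hnorm_ge0// ltW//; near: y.
pose l u := lim ((fun x => x u) @ F).
have lP u (e : R) : 0 < e -> \forall x \near F, hnorm ((x : bop H) u - l u) <= e.
  move=> e0; have /cvgrPdist_le/(_ e%:C) := pcv u.
  rewrite ltcR => /(_ e0); apply: filterS => x.
  by rewrite hnormE lecR hnorm_distC.
have lb x (e : R) : (\forall y \near F, `|x - y| < e) ->
    forall u, hnorm (x u - l u) <= e * hnorm u.
  move=> xe u; apply/ler_addgt0Pr => d d0.
  near F => y; have -> : x u - l u = (x - y) u + (y u - l u).
    by rewrite bop_subE subrKA.
  apply: (le_trans (ler_hnormD _ _)); rewrite lerD//; last first.
    by near: y; exact: lP.
  apply: (le_trans (hnorm_bop _ _)); rewrite ler_wpM2r ?hnorm_ge0// ltW//.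
  by near: y.
have l_lin : linear l.
  move=> a u v; apply/eqP; rewrite -subr_eq0 -hnorm_eq0 eq_le hnorm_ge0 andbT.
  apply/ler_addgt0Pr => e e0; rewrite add0r.
  pose na := Num.sqrt (complex.Re a ^+ 2 + complex.Im a ^+ 2) + 1.
  have na0 : 0 < na by rewrite ltr_wpDl ?sqrtr_ge0.
  have hZ z : hnorm (a *: z) <= na * hnorm z.
    rewrite -lecR rmorphM /= -!hnormE normrZ ler_wpM2r//.
    by rewrite normc_def lecR /na; case: (a) => ? ? /=; rewrite lerDl.
  near F => x.
  have -> : l (a *: u + v) - (a *: l u + l v) =
      - (x (a *: u + v) - l (a *: u + v)) + (a *: (x u - l u) + (x v - l v)).
    rewrite bopD bopZ scalerBr opprB -!addrA; congr (_ + _).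
    rewrite !opprD !addrA; congr (_ - _).
    by rewrite [RHS](ACl ((1*3)*(2*5)*4))/= !addNr !add0r.
  have -> : e = e / 4 + (e / 2 + e / 4) by field.
  apply: (le_trans (ler_hnormD _ _)); apply: lerD.
    rewrite hnorm_opp.
    by near: x; apply: lP; rewrite divr_gt0.
  apply: (le_trans (ler_hnormD _ _)).
  apply: lerD; last by near: x; apply: lP; rewrite divr_gt0.
  apply: (le_trans (hZ _)); rewrite -ler_pdivlMl//.
  by near: x; apply: lP; rewrite mulr_gt0 ?invr_gt0// divr_gt0.
have [x1 x11] := FcE 1 ltr01.
have l_bnd : exists c : R, op_bound l c.
  exists (`|x1| + 1) => u.
  rewrite !hnormE -rmorphM lecR.
  have -> : l u = x1 u + - (x1 u - l u) by rewrite opprB addrCA subrr addr0.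
  apply: (le_trans (ler_hnormD _ _)); rewrite mulrDl lerD ?hnorm_bop//.
  by rewrite opprB hnorm_distC; exact: lb.
pose L := Bop l_lin l_bnd.
apply/cvg_ex; exists L; apply/cvgrPdist_le => e e0.
have [x xe] := FcE (e / 2) (divr_gt0 e0 (ltr0Sn R 1)).
near=> y; rewrite [e]splitr.
have -> : L - y = - (x - L) + (x - y) by rewrite opprB subrKA.
apply: (le_trans (ler_normD _ _)); rewrite normrN lerD//; last first.
  by rewrite ltW//; near: y.
apply: bop_norm_le => [|u]; first by rewrite divr_ge0// ltW.
by rewrite bop_subE; apply: lb.
Unshelve. all: by end_near. Qed.

HB.instance Definition _ := Uniform_isComplete.Build (bop H) bop_complete.

End Completeness.

(** * The operator exponential *)

Section Algebra.
Variables (R : realType) (H : completeNormedModType R[i]).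
Implicit Types (x y z : bop H) (u v : H).

Lemma bop_mulE x y u : (x * y) u = x (y u). Proof. by []. Qed.

Lemma bop_scaleE (a : R) x u : (a *: x) u = a%:C *: x u. Proof. by []. Qed.

Lemma bopZl (a : R) x y : (a *: x) * y = a *: (x * y).
Proof. by apply: bop_ext => u. Qed.

Lemma bopZr (a : R) x y : x * (a *: y) = a *: (x * y).
Proof. by apply: bop_ext => u; rewrite /= bopZ. Qed.

Lemma bop_norm1 : `|1 : bop H| <= 1.
Proof. by apply: bop_norm_le => // u; rewrite mul1r. Qed.

Lemma bop_normM x y : `|x * y| <= `|x| * `|y|.
Proof.
apply: bop_norm_le => [|u]; first by rewrite mulr_ge0.
rewrite bop_mulE (le_trans (hnorm_bop _ _))// -mulrA ler_wpM2l//.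
exact: hnorm_bop.
Qed.

Lemma bop_normX x n : `|x ^+ n| <= `|x| ^+ n.
Proof.
elim: n => [|n IHn]; first by rewrite !expr0 bop_norm1.
by rewrite !exprS (le_trans (bop_normM _ _))// ler_wpM2l.
Qed.

Lemma cvg_bopM {T : Type} {F : set_system T} {FF : Filter F}
    (f g : T -> bop H) x y :
  f @ F --> x -> g @ F --> y -> (fun t => f t * g t) @ F --> x * y.
Proof.
move=> fx gy; apply/cvgrPdist_le => e e0.
have h0 : (fun t => `|f t - x| * `|g t| + `|x| * `|g t - y|) @ F -->
    (0 * `|y| + `|x| * 0 : R).
  apply: cvgD; apply: cvgM.
  - rewrite -[X in _ --> X](normr0 (bop H)) -(subrr x).
    by apply: cvg_norm; apply: cvgB => //; exact: cvg_cst.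
  - exact: cvg_norm.
  - exact: cvg_cst.
  - rewrite -[X in _ --> X](normr0 (bop H)) -(subrr y).
    by apply: cvg_norm; apply: cvgB => //; exact: cvg_cst.
move: h0; rewrite mul0r mulr0 addr0 => /cvgrPdist_le/(_ e e0).
apply: filterS => t; rewrite sub0r normrN ger0_norm ?addr_ge0 ?mulr_ge0//.
apply: le_trans; rewrite distrC.
have -> : f t * g t - x * y = (f t - x) * g t + x * (g t - y).
  by rewrite mulrBl mulrBr addrA subrK.
by rewrite (le_trans (ler_normD _ _))// lerD// bop_normM.
Qed.

Definition eterm x n := (n`!%:R : R)^-1 *: x ^+ n.

Lemma eterm0 x : eterm x 0 = 1.
Proof. by rewrite /eterm expr0 fact0 invr1 scale1r. Qed.

Lemma eterm1 x : eterm x 1 = x.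
Proof. by rewrite /eterm expr1 factS fact0 invr1 scale1r. Qed.

Lemma norm_eterm x n : `|eterm x n| <= exp_coeff `|x| n.
Proof.
rewrite normrZ ger0_norm ?invr_ge0// mulrC ler_wpM2r ?invr_ge0//.
exact: bop_normX.
Qed.

Lemma expop_cvg x : series (eterm x) @ \oo --> expop x.
Proof.
apply: (@normed_cvg _ (bop H)).
by apply: (@series_le_cvg _ _ (exp_coeff `|x|)) => [n|n|n|] /=;
  [exact: normr_ge0|exact: exp_coeff_ge0|exact: norm_eterm|
   exact: is_cvg_series_exp_coeff].
Qed.

Lemma expR_cvg (r : R) : series (exp_coeff r) @ \oo --> expR r.
Proof. exact: is_cvg_series_exp_coeff. Qed.

Lemma bin_invfact (n i : nat) : (i <= n)%N ->
  (n`!%:R : R)^-1 * 'C(n, i)%:R = ((n - i)`!%:R)^-1 * (i`!%:R)^-1.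
Proof.
move=> ni; rewrite -(bin_fact ni) !natrM !invfM.
have : 'C(n, i)%:R != 0 :> R by rewrite pnatr_eq0 -lt0n bin_gt0.
by move=> b0; rewrite mulrAC mulVf// mul1r mulrC.
Qed.

Lemma etermD x y n : GRing.comm x y ->
  eterm (x + y) n = \sum_(0 <= i < n.+1) eterm x (n - i) * eterm y i.
Proof.
move=> xy; rewrite /eterm exprDn_comm// scaler_sumr big_mkord.
apply: eq_bigr => i _; rewrite bopZl bopZr -[_ *+ 'C(n, i)](@scaler_nat R) !scalerA.
by rewrite bin_invfact// -ltnS.
Qed.

Lemma exp_coeffD (a b : R) n : exp_coeff (a + b) n =
  \sum_(0 <= i < n.+1) exp_coeff a (n - i)%N * exp_coeff b i.
Proof.
rewrite /exp_coeff /= exprDn mulr_suml big_mkord.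
apply: eq_bigr => i _; rewrite -[_ *+ 'C(n, i)]mulr_natr.
rewrite -!mulrA ['C(n, i)%:R / _]mulrC (bin_invfact (leq_ord i)).
by rewrite mulrA mulrACA -!mulrA.
Qed.

Lemma sum_triangle (V : nmodType) (F : nat -> nat -> V) n :
  \sum_(0 <= k < n) \sum_(0 <= i < k.+1) F (k - i)%N i =
  \sum_(0 <= i < n) \sum_(0 <= j < n | (i + j < n)%N) F j i.
Proof.
have -> : \sum_(0 <= k < n) \sum_(0 <= i < k.+1) F (k - i)%N i =
    \sum_(0 <= k < n) \sum_(0 <= i < n | (i < k.+1)%N) F (k - i)%N i.
  by apply: eq_big_nat => k /andP[_ kn]; rewrite (big_nat_widen _ k.+1 n).
rewrite (exchange_big_dep_nat xpredT)//=; apply: eq_big_nat => i /andP[_ lin].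
transitivity (\sum_(i <= k < n) F (k - i)%N i).
  rewrite [RHS](big_nat_widenl i 0)//.
have -> : \sum_(i <= k < n) F (k - i)%N i = \sum_(0 + i <= k < n) F (k - i)%N i by [].
rewrite big_addn.
under eq_bigr do rewrite addnK.
rewrite (big_nat_widen _ _ n) ?leq_subr//; apply: eq_bigl => j /=.
by rewrite ltn_subRL.
Qed.

(** The product of two partial sums of exponentials exceeds the partial sum of the
    Cauchy product by the pairs outside the triangle.  For real exponentials this
    excess tends to 0 because exp (a + b) = exp a * exp b. *)
Lemma cvg_square_exp_coeff (a b : R) :
  (fun n => \sum_(0 <= i < n) \sum_(0 <= j < n | ~~ (i + j < n)%N)
      exp_coeff a j * exp_coeff b i) @ \oo --> (0 : R).
Proof.
have cP : (fun n => series (exp_coeff a) n * series (exp_coeff b) n) @ \oo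
    --> expR a * expR b by apply: cvgM; exact: expR_cvg.
have : (fun n => series (exp_coeff a) n * series (exp_coeff b) n -
    series (exp_coeff (a + b)) n) @ \oo --> expR a * expR b - expR (a + b).
  by apply: cvgB => //; exact: expR_cvg.
rewrite -expRD subrr.
apply: cvg_trans.
apply: near_eq_cvg; apply: nearW => n /=.
rewrite /series /= mulr_sumr.
rewrite [X in _ - X](eq_bigr _ (fun k _ => exp_coeffD a b k)).
rewrite (sum_triangle (fun j i => exp_coeff a j * exp_coeff b i)) -sumrB.
apply: eq_bigr => i _.
rewrite mulr_suml [X in X - _](bigID (fun j => (i + j < n)%N))/=.
by rewrite addrAC subrr add0r.
Qed.

(** The excess of the product of partial sums over the Cauchy product is dominated, in
    norm, by the same excess for the real numbers |x| and |y|. *)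
Lemma expopD x y : GRing.comm x y -> expop (x + y) = expop x * expop y.
Proof.
move=> xy; apply/eqP; rewrite eq_sym -subr_eq0; apply/eqP.
have cP : (fun n => series (eterm x) n * series (eterm y) n) @ \oo
    --> expop x * expop y by apply: cvg_bopM; exact: expop_cvg.
have : (fun n => series (eterm x) n * series (eterm y) n -
    series (eterm (x + y)) n) @ \oo --> expop x * expop y - expop (x + y).
  by apply: cvgB => //; exact: expop_cvg.
move=> /cvg_unique; apply=> //.
apply/cvgr0Pnorm_le => e e0.
have /cvgr0Pnorm_le/(_ e e0) := @cvg_square_exp_coeff `|x| `|y|.
apply: filterS => n; apply: le_trans.
rewrite /= /series /= mulr_sumr.
rewrite [X in _ - X](eq_bigr _ (fun k _ => etermD k xy)).
rewrite (sum_triangle (fun j i => eterm x j * eterm y i)) -sumrB.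
rewrite ger0_norm; last first.
  by rewrite !sumr_ge0// => i _; rewrite sumr_ge0// => j _; rewrite mulr_ge0 ?exp_coeff_ge0.
rewrite (le_trans (ler_norm_sum _ _ _))// ler_sum// => i _.
rewrite mulr_suml [X in X - _](bigID (fun j => (i + j < n)%N))/=.
rewrite addrAC subrr add0r (le_trans (ler_norm_sum _ _ _))// ler_sum// => j _.
by rewrite (le_trans (bop_normM _ _))// ler_pM// norm_eterm.
Qed.

Lemma expop0 : expop (0 : bop H) = 1.
Proof.
apply: cvg_unique (@expop_cvg 0) _ => //.
apply: cvg_near_cst; exists 1%N => // -[//|n] _ /=.
rewrite /series /= big_nat_recl// big1 ?addr0 => [|k _].
  exact: eterm0.
by rewrite /eterm exprS mul0r scaler0.
Qed.

Lemma norm_subX x y (r : R) n : `|x| <= r -> `|y| <= r ->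
  `|x ^+ n.+1 - y ^+ n.+1| <= n.+1%:R * r ^+ n * `|x - y|.
Proof.
move=> xr yr; have r0 : 0 <= r by exact: le_trans xr.
elim: n => [|n IHn]; first by rewrite !expr1 expr0 !mul1r.
have -> : x ^+ n.+2 - y ^+ n.+2 =
    x * (x ^+ n.+1 - y ^+ n.+1) + (x - y) * y ^+ n.+1.
  by rewrite mulrBr mulrBl -!exprS addrA subrK.
rewrite (le_trans (ler_normD _ _))//.
have -> : n.+2%:R * r ^+ n.+1 * `|x - y| =
    r * (n.+1%:R * r ^+ n * `|x - y|) + `|x - y| * r ^+ n.+1.
  by rewrite -(natr1 n.+1) exprS; ring.
rewrite lerD// (le_trans (bop_normM _ _))// ler_pM//.
by rewrite (le_trans (bop_normX _ _))// lerXn2r ?nnegrE.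
Qed.

(** Up to a factor exp r - 1, which is small with r, the exponential moves like the
    identity.  This one estimate gives continuity, the derivative at 0, the
    logarithm near 1, and the injectivity of exp at 0. *)
Lemma expop_lip x y (r : R) : `|x| <= r -> `|y| <= r ->
  `|expop x - expop y - (x - y)| <= (expR r - 1) * `|x - y|.
Proof.
move=> xr yr; have r0 : 0 <= r by exact: le_trans xr.
have cL : (fun n => series (eterm x) (n + 2)%N - series (eterm y) (n + 2)%N - (x - y))
    @ \oo --> expop x - expop y - (x - y).
  apply: cvgB; last exact: cvg_cst.
  by apply: cvgB; [rewrite (cvg_shiftn 2 (series (eterm x)))|
    rewrite (cvg_shiftn 2 (series (eterm y)))]; exact: expop_cvg.
have cR : (fun n => (series (exp_coeff r) (n + 1)%N - 1) * `|x - y|)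
    @ \oo --> (expR r - 1) * `|x - y|.
  apply: cvgM; last exact: cvg_cst.
  apply: cvgB; last exact: cvg_cst.
  by rewrite (cvg_shiftn 1 (series (exp_coeff r))); exact: expR_cvg.
apply: ler_cvg_to (cvg_norm cL) cR _.
apply: nearW => n /=.
rewrite addn2 addn1 /series /= !(big_nat_recl n.+1)//= !(big_nat_recl n)//=.
rewrite !eterm0 !eterm1.
have -> : exp_coeff r 0%N = 1 by rewrite /exp_coeff /= expr0 fact0 divr1.
rewrite [1 + _ - 1]addrAC subrr add0r.
have -> : 1 + (x + \sum_(0 <= i < n) eterm x i.+2) -
    (1 + (y + \sum_(0 <= i < n) eterm y i.+2)) - (x - y) =
    \sum_(0 <= i < n) (eterm x i.+2 - eterm y i.+2).
  rewrite sumrB !opprD !opprK !addrA.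
  by rewrite [LHS](ACl ((1*4)*(2*7)*(5*8)*3*6))/= !subrr addNr !add0r.
rewrite mulr_suml (le_trans (ler_norm_sum _ _ _))// ler_sum// => i _.
rewrite /eterm -scalerBr normrZ ger0_norm ?invr_ge0// ler_pdivrMl ?ltr0n ?fact_gt0//.
rewrite (le_trans (norm_subX _ xr yr))// mulrA ler_wpM2r// /exp_coeff /=.
rewrite factS natrM -mulrA [X in _ <= _ * X]mulrC divfK//.
Qed.

Lemma expop_cvg_to {T : Type} {F : set_system T} {FF : Filter F}
    (f : T -> bop H) x :
  f @ F --> x -> (fun t => expop (f t)) @ F --> expop x.
Proof.
move=> fx; apply/cvgrPdist_le => e e0.
pose K := expR (`|x| + 1).
have K0 : 0 < K by exact: expR_gt0.
have /cvgrPdist_le/(_ (Num.min 1 (e / K))) := fx.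
rewrite lt_min ltr01 divr_gt0// => /(_ isT); apply: filterS => t.
rewrite le_min => /andP[d1 de].
have := @expop_lip x (f t) (`|x| + 1).
rewrite lerDl ler01 => /(_ isT).
have -> : `|f t| <= `|x| + 1.
  by rewrite -lerBlDl (le_trans _ d1)// distrC lerB_dist.
move=> /(_ isT) h; rewrite -[expop x - _](subrK (x - f t)).
rewrite (le_trans (ler_normD _ _))// (le_trans (lerD h (lexx _)))//.
by rewrite -[X in _ + X]mul1r -mulrDl subrK mulrC -ler_pdivlMr.
Qed.

Lemma comm_expop x y : GRing.comm x y -> GRing.comm x (expop y).
Proof.
move=> xy; have cy := @expop_cvg y.
have c1 : (fun n => x * series (eterm y) n) @ \oo --> x * expop y.
  by apply: cvg_bopM => //; exact: cvg_cst.
have c2 : (fun n => series (eterm y) n * x) @ \oo --> expop y * x.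
  by apply: cvg_bopM => //; exact: cvg_cst.
have e12 : (fun n => x * series (eterm y) n) = (fun n => series (eterm y) n * x).
  apply/funext => n; rewrite /series /= mulr_sumr mulr_suml.
  by apply: eq_bigr => i _; rewrite bopZl bopZr (commrX i xy).
by rewrite /GRing.comm; apply: cvg_unique c1 _ => //; rewrite e12.
Qed.

Lemma expopN x : expop x * expop (- x) = 1.
Proof. by rewrite -expopD ?subrr ?expop0//; exact: commrN. Qed.

Lemma expopNr x : expop (- x) * expop x = 1.
Proof. by rewrite -{2}[x]opprK expopN. Qed.

Lemma expop_scaleD x (a b : R) :
  expop ((a + b) *: x) = expop (a *: x) * expop (b *: x).
Proof.
by rewrite scalerDl expopD// /GRing.comm !bopZl !bopZr !scalerA mulrC.
Qed.

Lemma expop_half x : expop x = expop (2^-1 *: x) * expop (2^-1 *: x).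
Proof. by rewrite -expop_scaleD -div1r -splitr scale1r. Qed.

Lemma invopP x y : x * y = 1 -> y * x = 1 -> invop x = y.
Proof.
move=> xy yx; apply: xget_unique => // z [xz zx].
by rewrite -[z]mulr1 -xy mulrA zx mul1r.
Qed.

Lemma invop_expop x : invop (expop x) = expop (- x).
Proof. by apply: invopP; [exact: expopN|exact: expopNr]. Qed.

Lemma expop_deriv0 x :
  (fun s : R => s^-1 *: (expop (s *: x) - 1)) @ 0^' --> x.
Proof.
apply/cvgrPdist_le => e e0.
have : (fun s : R => (expR (`|s| * `|x|) - 1) * `|x|) @ 0^' -->
    (expR (`|0 : R| * `|x|) - 1) * `|x|.
  apply: cvgM; last exact: cvg_cst.
  apply: cvgB; last exact: cvg_cst.
  have c : (fun s : R => `|s| * `|x|) @ 0^' --> `|0 : R| * `|x|.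
    apply: cvgM; last exact: cvg_cst.
    by apply: cvg_norm; exact: nbhs_dnbhs.
  by apply: continuous_cvg c; exact: continuous_expR.
rewrite normr0 mul0r expR0 subrr mul0r => /cvgr0Pnorm_le/(_ e e0) h.
near=> s.
have s0 : s != 0 by near: s; exact: nbhs_dnbhs_neq.
have -> : x - s^-1 *: (expop (s *: x) - 1) =
    - (s^-1 *: (expop (s *: x) - expop 0 - (s *: x - 0))).
  by rewrite expop0 subr0 [in RHS]scalerBr opprB scalerA mulVf// scale1r.
rewrite normrN normrZ normfV ler_pdivrMl ?normr_gt0//.
have sx : `|s *: x| <= `|s| * `|x| by rewrite normrZ.
have o0 : `|0 : bop H| <= `|s| * `|x| by rewrite normr0 mulr_ge0.
apply: (le_trans (expop_lip sx o0)); rewrite subr0 normrZ mulrCA ler_wpM2l//.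
have : `|(expR (`|s| * `|x|) - 1) * `|x| | <= e by near: s.
by apply: le_trans; exact: ler_norm.
Unshelve. all: by end_near. Qed.

End Algebra.

(** * Adjoints *)

Lemma Re_conj (R : rcfType) (z : R[i]) : complex.Re (Num.conj z) = complex.Re z.
Proof. by case: z. Qed.

Lemma ReD (R : rcfType) (z t : R[i]) :
  complex.Re (z + t) = complex.Re z + complex.Re t.
Proof. by case: z; case: t. Qed.

Lemma ReN (R : rcfType) (z : R[i]) : complex.Re (- z) = - complex.Re z.
Proof. by case: z. Qed.

Lemma ReZ (R : rcfType) (c : R) (z : R[i]) :
  complex.Re (c%:C * z) = c * complex.Re z.
Proof. by case: z => a b /=; rewrite mul0r subr0. Qed.

Section HilbertSpace.
Variables (R : realType) (H : completeNormedModType R[i]).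
Variables (form : {dot H for @Num.conj R[i]}) (form_norm : hilbert_form form).
Implicit Types (x y z : bop H) (u v w : H).

(** The underlying real inner product: adjoints and positivity can be tested on real
    parts alone. *)
Definition rform u v : R := complex.Re (form u v).

Lemma rformC u v : rform u v = rform v u.
Proof. by rewrite /rform hermC expr0 mul1r Re_conj. Qed.

Lemma rformDl u v w : rform (u + v) w = rform u w + rform v w.
Proof. by rewrite /rform linearDl ReD. Qed.

Lemma rformDr u v w : rform u (v + w) = rform u v + rform u w.
Proof. by rewrite !(rformC u) rformDl. Qed.

Lemma rformZl (c : R) u v : rform (c%:C *: u) v = c * rform u v.
Proof.
by rewrite /rform linearZl_LR ReZ.
Qed.

Lemma rformZr (c : R) u v : rform u (c%:C *: v) = c * rform u v.
Proof. by rewrite !(rformC u) rformZl. Qed.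

Lemma rformNl u v : rform (- u) v = - rform u v.
Proof. by rewrite /rform linearNl ReN. Qed.

Lemma rformNr u v : rform u (- v) = - rform u v.
Proof. by rewrite !(rformC u) rformNl. Qed.

Lemma rform_id u : rform u u = hnorm u ^+ 2.
Proof.
apply: (@complexI R); rewrite rmorphXn /= -hnormE form_norm /rform RRe_real//.
by rewrite -form_norm rpredX// normr_real.
Qed.

Lemma rform_CS u v : rform u v <= hnorm u * hnorm v.
Proof.
have [->|v0] := eqVneq v 0.
  by rewrite /rform linear0r /= mulr_ge0 ?hnorm_ge0.
have nv : 0 < hnorm v by rewrite lt_neqAle hnorm_ge0 eq_sym hnorm_eq0 v0.
have [->|u0] := eqVneq u 0.
  by rewrite /rform linear0l /= mulr_ge0 ?hnorm_ge0.
have nu : 0 < hnorm u by rewrite lt_neqAle hnorm_ge0 eq_sym hnorm_eq0 u0.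
have : 0 <= hnorm ((hnorm v)%:C *: u - (hnorm u)%:C *: v) ^+ 2 by rewrite sqr_ge0.
rewrite -rform_id rformDl !rformDr !rformNl !rformNr !rformZl !rformZr !rform_id.
rewrite [rform v u]rformC.
have : 0 < hnorm u * hnorm v by rewrite mulr_gt0.
by nra.
Qed.

(** The imaginary part is recovered by rotating the second argument by 'i, in which
    the form is conjugate linear. *)
Lemma form_rform u v : form u v = (rform u v +i* rform u ('i *: v))%C.
Proof.
rewrite /rform linearZr_LR /=; case: (form u v) => a b /=.
by rewrite mul0r sub0r mulNr opprK mul1r.
Qed.

Lemma adjointP x y :
  adjoint_of form x y <-> forall u v, rform (x u) v = rform u (y v).
Proof.
split=> xy u v; first by rewrite /rform xy.
by rewrite !form_rform !xy bopZ.
Qed.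

Notation adj := (adjoint_of form).

Lemma bopN x v : x (- v) = - x v.
Proof. by rewrite -[in LHS]scaleN1r bopZ scaleN1r. Qed.

Lemma adj_sym x y : adj x y -> adj y x.
Proof. by move=> /adjointP xy; apply/adjointP => u v; rewrite rformC -xy rformC. Qed.

Lemma adj0 : adj 0 0.
Proof. by apply/adjointP => u v; rewrite /rform /= linear0l linear0r. Qed.

Lemma adj1 : adj 1 1.
Proof. by apply/adjointP. Qed.

Lemma adjD x y x' y' : adj x x' -> adj y y' -> adj (x + y) (x' + y').
Proof.
move=> /adjointP xx /adjointP yy; apply/adjointP => u v.
by rewrite !bop_addE rformDl rformDr xx yy.
Qed.

Lemma adjZ (c : R) x x' : adj x x' -> adj (c *: x) (c *: x').
Proof.
move=> /adjointP xx; apply/adjointP => u v.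
by rewrite !bop_scaleE rformZl rformZr xx.
Qed.

Lemma adjB x y x' y' : adj x x' -> adj y y' -> adj (x - y) (x' - y').
Proof. by move=> xx yy; rewrite -(scaleN1r y) -(scaleN1r y'); apply/adjD/adjZ. Qed.

Lemma adjN x x' : adj x x' -> adj (- x) (- x').
Proof. by move=> xx; rewrite -(sub0r x) -(sub0r x'); exact: adjB adj0 xx. Qed.

Lemma adjM x y x' y' : adj x x' -> adj y y' -> adj (x * y) (y' * x').
Proof.
move=> /adjointP xx /adjointP yy; apply/adjointP => u v.
by rewrite !bop_mulE xx yy.
Qed.

Lemma norm_adj_le x y : adj x y -> `|y| <= `|x|.
Proof.
move=> /adjointP xy; apply: bop_norm_le => // v.
have [->|yv] := eqVneq (y v) 0.
  by rewrite /hnorm normr0 /= mulr_ge0// hnorm_ge0.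
have nyv : 0 < hnorm (y v) by rewrite lt_neqAle hnorm_ge0 eq_sym hnorm_eq0 yv.
rewrite -(ler_pM2r nyv) -expr2 -(rform_id (y v)) -xy.
rewrite (le_trans (rform_CS _ _))// mulrAC ler_wpM2r ?hnorm_ge0//.
exact: hnorm_bop.
Qed.

Lemma norm_adj x y : adj x y -> `|y| = `|x|.
Proof. by move=> xy; apply/eqP; rewrite eq_le !norm_adj_le//; exact: adj_sym. Qed.

Lemma adj_lim {T : Type} {F : set_system T} {FF : ProperFilter F}
    (f g : T -> bop H) x y :
  f @ F --> x -> g @ F --> y -> (\forall t \near F, adj (f t) (g t)) -> adj x y.
Proof.
move=> fx gy fg; apply/adjointP.
suff le u v : rform (x u) v <= rform u (y v).
  move=> u v; apply/eqP; rewrite eq_le le/=.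
  by rewrite -lerN2 -!rformNr -bopN le.
apply/ler_addgt0Pr => e e0.
pose C := hnorm u * hnorm v + 1.
have C0 : 0 < C by rewrite ltr_wpDl// mulr_ge0 ?hnorm_ge0.
have eC : 0 < e / C / 2 by rewrite !divr_gt0.
have /cvgrPdist_le/(_ _ eC) fxe := fx.
have /cvgrPdist_le/(_ _ eC) gye := gy.
near F => t.
have /adjointP fgt : adj (f t) (g t) by near: t.
have -> : rform (x u) v = rform ((x - f t) u) v + rform u (g t v).
  by rewrite -fgt -rformDl bop_subE subrK.
have -> : rform u (y v) + e = e + rform u ((y - g t) v) + rform u (g t v).
  by rewrite -addrA -rformDr bop_subE subrK addrC.
rewrite lerD2r -[rform u _]opprK -rformNl lerBrDl.
have h1 : rform ((x - f t) u) v <= e / C / 2 * C.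
  rewrite (le_trans (rform_CS _ _))// (@le_trans _ _ (e / C / 2 * (hnorm u * hnorm v)))//.
    rewrite mulrA ler_wpM2r ?hnorm_ge0// (le_trans (hnorm_bop _ _))//.
    by rewrite ler_wpM2r ?hnorm_ge0//; near: t.
  by rewrite (ler_wpM2l (ltW eC))// lerDl ler01.
have h2 : rform (- u) ((y - g t) v) <= e / C / 2 * C.
  rewrite (le_trans (rform_CS _ _))// (@le_trans _ _ (e / C / 2 * (hnorm u * hnorm v)))//.
    rewrite hnorm_opp mulrCA ler_wpM2l ?hnorm_ge0// (le_trans (hnorm_bop _ _))//.
    by rewrite ler_wpM2r ?hnorm_ge0//; near: t.
  by rewrite (ler_wpM2l (ltW eC))// lerDl ler01.
rewrite addrC (le_trans (lerD h1 h2))//.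
by rewrite -mulrDl -splitr divfK// gt_eqF.
Unshelve. all: by end_near. Qed.

End HilbertSpace.

(** * Logarithms near the identity *)

Section Subalgebra.
Variables (R : realType) (H : completeNormedModType R[i]).
Implicit Types (x y z : bop H) (S : set (bop H)).

(** Stability of a set of operators under everything used to build an exponential or a
    logarithm of one of its members. *)
Record closed_subalgebra S : Prop := ClosedSubalgebra {
  csa1 : S 1;
  csaD : forall x y, S x -> S y -> S (x + y);
  csaZ : forall (c : R) x, S x -> S (c *: x);
  csaM : forall x y, S x -> S y -> S (x * y);
  csa_lim : forall (T : Type) (F : set_system T) (FF : ProperFilter F)
    (f : T -> bop H) x, f @ F --> x -> (\forall t \near F, S (f t)) -> S x
}.

Section ClosedSubalgebra.
Variables (S : set (bop H)) (SA : closed_subalgebra S).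

Lemma csa0 : S 0.
Proof. by rewrite -(scale0r (1 : bop H)); apply: csaZ => //; exact: csa1. Qed.

Lemma csaN x : S x -> S (- x).
Proof. by move=> Sx; rewrite -scaleN1r; exact: csaZ. Qed.

Lemma csaB x y : S x -> S y -> S (x - y).
Proof. by move=> Sx Sy; apply: csaD => //; exact: csaN. Qed.

Lemma csaX x n : S x -> S (x ^+ n).
Proof.
move=> Sx; elim: n => [|n IHn]; first by rewrite expr0; exact: csa1.
by rewrite exprS; exact: csaM.
Qed.

Lemma csa_expop x : S x -> S (expop x).
Proof.
move=> Sx; apply: (csa_lim SA _ (@expop_cvg _ _ x)); apply: nearW => n.
rewrite /series /=; apply: big_ind => [|y z|i _]; [exact: csa0|exact: csaD|].
by apply: csaZ => //; exact: csaX.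
Qed.

(** The constant that makes the iteration below contract by 1/2. *)
Lemma expR_quarter : expR (4^-1 : R) - 1 <= 2^-1.
Proof.
have h : 3 / 4 <= expR (- 4^-1) :> R.
  by apply: le_trans (expR_ge1Dx _); rewrite le_eqVlt; apply/orP; left; apply/eqP; field.
have : (expR (- 4^-1))^-1 <= (3 / 4)^-1 :> R.
  by rewrite lef_pV2// posrE ?expR_gt0// divr_gt0.
by rewrite -expRN opprK => /le_trans; rewrite lerBlDr; apply; lra.
Qed.

(** The solution of exp y = x is the fixed point of y |-> y + x - exp y, which contracts
    by 1/2 on the ball of radius 1/4, by expop_lip; started at 0 with |x - 1| <= 1/8,
    the iteration stays in that ball and in S. *)
Lemma log_near1 x : S x -> `|x - 1| <= 8^-1 -> exists2 y, S y & expop y = x.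
Proof.
move=> Sx x1.
pose y_ := fix y n := if n is m.+1 then y m + (x - expop (y m)) else 0.
have Sy n : S (y_ n).
  elim: n => [|n IHn] /=; first exact: csa0.
  by apply: csaD => //; apply: csaB => //; exact: csa_expop.
have h2 : 0 < 2^-1 :> R by rewrite invr_gt0.
have dE n : y_ n.+1 - y_ n = x - expop (y_ n) by rewrite /= addrC addKr.
have yb n : `|y_ n| <= 4^-1 * (1 - (2^-1) ^+ n) /\
            `|y_ n.+1 - y_ n| <= 8^-1 * (2^-1) ^+ n.
  elim: n => [|n [IH1 IH2]].
    by rewrite /= normr0 expr0 subrr mulr0 expop0 add0r subr0 mulr1.
  have b1 : `|y_ n.+1| <= 4^-1 * (1 - (2^-1) ^+ n.+1).
    rewrite -(subrK (y_ n) (y_ n.+1)) (le_trans (ler_normD _ _))//.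
    rewrite (le_trans (lerD IH2 IH1))// exprS; lra.
  split=> //; rewrite dE.
  have -> : x - expop (y_ n.+1) =
      - (expop (y_ n.+1) - expop (y_ n) - (y_ n.+1 - y_ n)).
    by rewrite [in RHS]dE !opprB addrA subrK.
  have q m : (0 <= 2^-1 ^+ m :> R) by rewrite exprn_ge0// ltW.
  have p1 : `|y_ n.+1| <= 4^-1 by rewrite (le_trans b1)//; have := q n.+1; lra.
  have p0 : `|y_ n| <= 4^-1 by rewrite (le_trans IH1)//; have := q n; lra.
  rewrite normrN (le_trans (expop_lip p1 p0))//.
  have e0 : 0 <= expR (4^-1 : R) - 1 by rewrite subr_ge0 (le_trans _ (expR_ge1Dx _))// lerDl.
  rewrite (le_trans (ler_pM e0 (normr_ge0 _) expR_quarter IH2))//.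
  by rewrite exprS mulrCA.
have ycv : cvg (y_ @ \oo).
  have -> : y_ = series (fun n => y_ n.+1 - y_ n).
    apply/funext => n; rewrite /series /= telescope_sumr//.
    by rewrite /y_ subr0.
  apply: (@normed_cvg _ (bop H)).
  apply: (@series_le_cvg _ _ (geometric (8^-1) (2^-1))) => [n|n|n|] /=.
  - exact: normr_ge0.
  - by rewrite mulr_ge0 ?invr_ge0// exprn_ge0// invr_ge0.
  - by have [] := yb n.
  - by apply: is_cvg_geometric_series; rewrite ger0_norm ?invr_ge0// invf_lt1// ltr1n.
exists (lim (y_ @ \oo)).
  by apply: (csa_lim SA _ ycv); apply: nearW.
have c1 : (fun n => expop (y_ n)) @ \oo --> expop (lim (y_ @ \oo)).
  exact: expop_cvg_to.
have c2 : (fun n => x + y_ n - y_ (n + 1)%N) @ \oo --> x + lim (y_ @ \oo) - lim (y_ @ \oo).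
  apply: cvgB; first by apply: cvgD => //; exact: cvg_cst.
  by rewrite (cvg_shiftn 1 y_).
rewrite addrK in c2; apply: cvg_unique c1 _ => //.
apply: cvg_trans c2; apply: near_eq_cvg; apply: nearW => n.
by rewrite addn1 /= opprD addrA addrK opprB addrC subrK.
Qed.

End ClosedSubalgebra.
End Subalgebra.

(** * Logarithms of positive invertible operators *)

Section Logarithm.
Variables (R : realType) (H : completeNormedModType R[i]).
Variables (form : {dot H for @Num.conj R[i]}) (form_norm : hilbert_form form).
Implicit Types (x y z a b : bop H) (u v w : H) (S : set (bop H)).
Local Notation adj := (adjoint_of form).
Local Notation rform := (rform form).

Definition bounded_below a :=
  exists2 e : R, 0 < e & forall u, e * hnorm u ^+ 2 <= rform (a u) u.

Lemma norm_expop_opp y (e : R) : 0 < e ->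
  (forall u, e * hnorm u ^+ 2 <= rform (expop y u) u) -> `|expop (- y)| <= e^-1.
Proof.
move=> e0 ye; apply: bop_norm_le => [|u]; first by rewrite invr_ge0 ltW.
set v := expop (- y) u.
have yv : expop y v = u by rewrite /v -bop_mulE expopN.
rewrite ler_pdivlMl//.
have [->|v0] := eqVneq v 0; first by rewrite /hnorm normr0 /= mulr0 -/(hnorm u) hnorm_ge0.
have nv : 0 < hnorm v by rewrite lt_neqAle hnorm_ge0 eq_sym hnorm_eq0 v0.
rewrite -(ler_pM2r nv) -mulrA -expr2 (le_trans (ye _))// yv.
exact: rform_CS.
Qed.

Lemma adj_expop x y : adj x y -> adj (expop x) (expop y).
Proof.
move=> xy; apply: (adj_lim form_norm (@expop_cvg _ _ x) (@expop_cvg _ _ y)).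
apply: nearW => n; rewrite /series /=.
elim/big_rec2: _ => [|i y' x' _ IH].
  exact: adj0.
apply: adjD => //; apply: adjZ.
elim: i {IH} => [|i IHi]; first by rewrite !expr0; exact: adj1.
by rewrite exprS exprSr; exact: adjM.
Qed.

Lemma sa_expop x : selfadjoint form x -> selfadjoint form (expop x).
Proof. exact: adj_expop. Qed.

Lemma sa_scale (c : R) x : selfadjoint form x -> selfadjoint form (c *: x).
Proof. exact: adjZ. Qed.

(** Congruence by an operator with a bounded left inverse preserves positivity with a
    lower bound: the left inverse h controls |u| by |g u|. *)
Lemma bounded_below_congr a g g' h : adj g g' -> h * g = 1 ->
  bounded_below a -> bounded_below (g' * a * g).
Proof.
move=> /adj_sym/adjointP gg hg [e e0 ae].
have h1 : 0 < `|h| + 1 by rewrite ltr_wpDl.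
exists (e / (`|h| + 1) ^+ 2) => [|u]; first by rewrite divr_gt0// exprn_gt0.
rewrite !bop_mulE gg (le_trans _ (ae _))// -mulrA ler_pM2l//.
rewrite mulrC ler_pdivrMr ?exprn_gt0// -exprMn.
rewrite lerXn2r ?nnegrE ?mulr_ge0 ?hnorm_ge0 ?(ltW h1)//.
have {1}-> : u = h (g u) by rewrite -bop_mulE hg.
rewrite (le_trans (hnorm_bop _ _))// mulrC ler_wpM2l ?hnorm_ge0//.
by rewrite lerDl.
Qed.

Lemma bounded_below1 : bounded_below 1.
Proof. by exists 1 => // u; rewrite mul1r rform_id. Qed.

Lemma bounded_below_expop x : selfadjoint form x -> bounded_below (expop x).
Proof.
move=> sx; rewrite expop_half -[X in X * _]mulr1.
apply: (@bounded_below_congr _ _ _ (expop (- (2^-1 *: x)))).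
- exact/sa_expop/sa_scale.
- exact: expopNr.
- exact: bounded_below1.
Qed.

Section Global.
Variables (S : set (bop H)) (SA : closed_subalgebra S).
Hypothesis S_comm : forall x y, S x -> S y -> x * y = y * x.

(** If a >= e > 0, the segment from 1 to a stays above m = min (1, e), so its points have
    inverses of norm at most m^-1.  Cutting it into N equal steps, each quotient of
    consecutive points is within 1/8 of 1 and has a logarithm; S being
    commutative, the logarithms add up. *)
Lemma log_bounded_below a : S a -> bounded_below a ->
  exists2 y, S y & expop y = a.
Proof.
move=> Sa [e e0 ae].
pose at_ (t : R) := 1 + t *: (a - 1).
pose m := Num.min 1 e.
have m0 : 0 < m by rewrite lt_min ltr01.
have Sat t : S (at_ t).
  apply: csaD => //; first exact: csa1.
  by apply: csaZ => //; apply: csaB => //; exact: csa1.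
have atm (t : R) u : 0 <= t <= 1 -> m * hnorm u ^+ 2 <= rform (at_ t u) u.
  move=> /andP[t0 t1]; rewrite bop_addE bop_scaleE bop_subE rformDl rformZl.
  rewrite rformDl rformNl rform_id//.
  have m1 : m <= 1 by rewrite ge_min lexx.
  have me : m <= e by rewrite ge_min lexx orbT.
  have := ae u; have : 0 <= hnorm u ^+ 2 by rewrite sqr_ge0.
  move: (rform _ _) (hnorm u ^+ 2) => r h h0 hr.
  have : m * h <= r by apply: le_trans hr; rewrite ler_wpM2r.
  have : m * h <= h by rewrite ler_piMl.
  by nra.
pose N := (Num.truncn (`|a - 1| / m * 8)).+1.
have NP : `|a - 1| / m * 8 < N%:R by exact: truncnS_gt.
have NR : 0 < N%:R :> R by rewrite ltr0n.
have step k : (k <= N)%N -> exists2 y, S y & expop y = at_ (k%:R / N%:R).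
  elim: k => [_|k IH kN].
    by exists 0; [exact: csa0|rewrite expop0 /at_ mul0r scale0r addr0].
  have [y Sy ye] := IH (ltnW kN).
  pose c := expop (- y) * at_ (k.+1%:R / N%:R).
  have Sc : S c by apply: csaM => //; apply: csa_expop => //; exact: csaN.
  have c1 : c - 1 = N%:R^-1 *: (expop (- y) * (a - 1)).
    rewrite /c -[X in _ - X = _](expopNr y) ye -mulrBr -bopZr; congr (_ * _).
    rewrite /at_ opprD addrACA subrr add0r -scalerBl; congr (_ *: _).
    by rewrite -mulrBl -natrB// subSnn mul1r.
  have cn : `|c - 1| <= 8^-1.
    rewrite c1 normrZ normfV ger0_norm// ler_pdivrMl//.
    rewrite (le_trans (bop_normM _ _))//.
    rewrite (@le_trans _ _ (m^-1 * `|a - 1|))//.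
      rewrite ler_wpM2r// norm_expop_opp// => u; rewrite ye; apply: atm.
      by rewrite divr_ge0//= ler_pdivrMr// mul1r ler_nat ltnW.
    by rewrite ler_pdivlMr// [m^-1 * _]mulrC ltW.
  have [y' Sy' y'c] := log_near1 SA Sc cn.
  exists (y + y'); first exact: csaD.
  by rewrite expopD; [rewrite y'c /c mulrA expopN mul1r|exact: S_comm].
have [y Sy ye] := step N (leqnn N); exists y => //.
by rewrite ye /at_ divff ?gt_eqF// scale1r addrC subrK.
Qed.

End Global.

(** With w = exp (z / 2), the relation (w + 1) (w - 1) = 0 forces w = 1, since w is
    positive. *)
Lemma expop_eq1_half z : selfadjoint form z -> expop z = 1 ->
  expop (2^-1 *: z) = 1.
Proof.
move=> sz z1; set w := expop (2^-1 *: z).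
have ww : w * w = 1 by rewrite -z1 [RHS]expop_half.
have [e e0 we] : bounded_below w by exact/bounded_below_expop/sa_scale.
apply/eqP; rewrite -subr_eq0; apply/eqP/bop_ext => u.
set v := (w - 1) u.
have wv : w v = - v.
  rewrite /v -bop_mulE mulrBr mulr1 ww !bop_subE opprB //.
apply/eqP; rewrite -hnorm_eq0 -sqrf_eq0.
have := we v; rewrite wv rformNl rform_id//.
have : 0 <= hnorm v ^+ 2 by rewrite sqr_ge0.
by move: (hnorm v ^+ 2) => r r0 er; apply/eqP; nra.
Qed.

(** Halving repeatedly, exp (z / 2^n) = 1 with z / 2^n arbitrarily small, where exp is
    injective by expop_lip. *)
Lemma expop_eq1 z : selfadjoint form z -> expop z = 1 -> z = 0.
Proof.
move=> sz z1.
have zn n : expop (2^-1 ^+ n *: z) = 1.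
  elim: n => [|n IHn]; first by rewrite expr0 scale1r.
  by rewrite exprS -scalerA; apply: expop_eq1_half => //; exact: sa_scale.
pose N := (Num.truncn (`|z| * 4)).+1.
have NP : `|z| * 4 < N%:R by exact: truncnS_gt.
have N2 : N%:R <= 2 ^+ N :> R by rewrite -natrX ler_nat ltnW// ltn_expl.
pose c : R := 2^-1 ^+ N; pose y := c *: z.
have c0 : 0 < c by rewrite exprn_gt0// invr_gt0.
have y4 : `|y| <= 4^-1.
  rewrite normrZ gtr0_norm// /c exprVn ler_pdivrMl ?exprn_gt0//.
  by rewrite ler_pdivlMr// (le_trans (ltW NP)).
have o4 : `|0 : bop H| <= 4^-1 by rewrite normr0 invr_ge0.
have := expop_lip y4 o4; rewrite [expop y]zn expop0 subrr sub0r subr0 normrN => yle.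
have : `|y| <= 2^-1 * `|y|.
  by rewrite (le_trans yle)// ler_wpM2r// expR_quarter.
rewrite mulrC ler_pdivlMr// mulr_natr mulr2n gerDl.
by rewrite normr_le0 scaler_eq0 gt_eqF//= => /eqP.
Qed.

Lemma expop_inj_comm x y : selfadjoint form x -> selfadjoint form y ->
  x * y = y * x -> expop x = expop y -> x = y.
Proof.
move=> sx sy xy exy; apply/eqP; rewrite -subr_eq0; apply/eqP.
apply: expop_eq1; first exact: adjB.
by rewrite expopD; [rewrite exy expopN|exact: commrN].
Qed.

Section VonNeumannAlgebra.
Variables (A : set (bop H)) (A_vna : von_neumann_algebra form A).

Lemma commutant_subalgebra (B : set (bop H)) : closed_subalgebra (commutant B).
Proof.
split.
- by move=> y _; rewrite mul1r mulr1.
- by move=> x y Bx By z Bz; rewrite mulrDl mulrDr Bx// By.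
- by move=> c x Bx z Bz; rewrite bopZl bopZr Bx.
- by move=> x y Bx By z Bz; rewrite -mulrA By// mulrA Bx// mulrA.
move=> T F FF f x fx fB z Bz.
have c1 : (fun t => f t * z) @ F --> x * z by apply: cvg_bopM => //; exact: cvg_cst.
have c2 : (fun t => z * f t) @ F --> z * x by apply: cvg_bopM => //; exact: cvg_cst.
apply: cvg_unique c1 _ => //; apply: cvg_trans c2; apply: near_eq_cvg.
by apply: filterS fB => t /(_ z Bz).
Qed.

Lemma vna_subalgebra : closed_subalgebra A.
Proof. by rewrite -(vna_bicommutant A_vna); exact: commutant_subalgebra. Qed.

(** A commutative algebra in which the logarithm of a can be built.  Its elements
    commute with everything that commutes with a, in particular with any other
    selfadjoint logarithm of a, which is why that one must be equal. *)
Definition sa_bicommutant a : set (bop H) :=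
  [set x | sa_part form A x /\ commutant (commutant [set a]) x].

Lemma sa_bicommutant_comm a x y : sa_part form A a ->
  sa_bicommutant a x -> sa_bicommutant a y -> x * y = y * x.
Proof.
move=> Aa [_ ax] [_ ay]; apply: ax => z ->.
by apply: ay => _ ->.
Qed.

Lemma sa_bicommutant_subalgebra a : sa_part form A a ->
  closed_subalgebra (sa_bicommutant a).
Proof.
move=> Aa; have C := sa_bicommutant_comm Aa.
have VA := vna_subalgebra; have CA := commutant_subalgebra (commutant [set a]).
split.
- by split; [split; [exact: (csa1 VA)|exact: adj1]|exact: (csa1 CA)].
- move=> x y [[Ax sx] cx] [[Ay sy] cy]; split; last exact: (csaD CA).
  by split; [exact: (csaD VA)|exact: adjD].
- move=> c x [[Ax sx] cx]; split; last exact: (csaZ CA).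
  by split; [exact: (csaZ VA)|exact: adjZ].
- move=> x y Sx Sy; have xy := C _ _ Sx Sy.
  move: Sx Sy => [[Ax sx] cx] [[Ay sy] cy]; split; last exact: (csaM CA).
  split; first exact: (csaM VA).
  by rewrite /selfadjoint {2}xy; exact: adjM.
move=> T F FF f x fx fS; split; last first.
  by apply: (csa_lim CA _ fx); apply: filterS fS => t [].
split; first by apply: (csa_lim VA _ fx); apply: filterS fS => t [[]].
by apply: (adj_lim form_norm fx fx); apply: filterS fS => t [[]].
Qed.

Lemma log_sa_bicommutant a : sa_part form A a -> bounded_below a ->
  exists2 y, sa_bicommutant a y & expop y = a.
Proof.
move=> Aa ba; apply: (log_bounded_below (sa_bicommutant_subalgebra Aa)) => //.
  by move=> x y; exact: sa_bicommutant_comm.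
by split=> // z za; exact/esym/za.
Qed.

Lemma sa_part_expop x : sa_part form A x -> sa_part form A (expop x).
Proof.
by move=> [Ax sx]; split; [exact: (csa_expop vna_subalgebra)|exact: sa_expop].
Qed.

(** Being bounded below is visibly preserved by congruence (bounded_below_congr), which
    is hard to see on exponentials. *)
Lemma SigmaP a : Sigma form A a <-> sa_part form A a /\ bounded_below a.
Proof.
split=> [[x Ax <-]|[Aa ba]].
  by split; [exact: sa_part_expop|apply: bounded_below_expop; case: Ax].
by have [y [Ay _] ya] := log_sa_bicommutant Aa ba; exists y.
Qed.

(** Any two selfadjoint logarithms of exp x commute with the one built in
    sa_bicommutant, hence coincide with it by expop_inj_comm.  The competitor is any
    selfadjoint operator on H, not only one of A. *)
Lemma logop_expop x : sa_part form A x -> logop form (expop x) = x.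
Proof.
move=> Ax; have [Aa ba] : sa_part form A (expop x) /\ bounded_below (expop x).
  by apply/SigmaP; exists x.
have [y [Ay cy] ya] := log_sa_bicommutant Aa ba.
have yE z : selfadjoint form z -> expop z = expop x -> z = y.
  move=> sz zx; apply: expop_inj_comm => //; first by case: Ay.
    apply/esym/cy => _ ->; rewrite -zx; exact/comm_expop.
  by rewrite zx.
have sx : selfadjoint form x by case: Ax.
apply: xget_unique; first by split.
by move=> z [sz zx]; rewrite (yE z)// -(yE x).
Qed.

Lemma powop_expop x t : sa_part form A x -> powop form (expop x) t = expop (t *: x).
Proof. by move=> Ax; rewrite /powop logop_expop. Qed.

End VonNeumannAlgebra.

End Logarithm.

(** * The trace *)

Section Trace.
Variables (R : realType) (H : completeNormedModType R[i]).
Variables (form : {dot H for @Num.conj R[i]}) (form_norm : hilbert_form form).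
Variables (A : set (bop H)) (A_vna : von_neumann_algebra form A).
Variables (tau : bop H -> R[i]) (tau_state : fn_tracial_state form A tau).
Implicit Types (x y z a b : bop H) (u v w : H).
Local Notation adj := (adjoint_of form).
Local Notation Ah := (sa_part form A).

(** The metric ip_at involves real parts of traces only. *)
Definition rtau x : R := complex.Re (tau x).
Local Notation T := rtau.

Let AA : closed_subalgebra A := vna_subalgebra A_vna.

(** The elements of A with an adjoint.  Every operator to be traced is a
    polynomial in selfadjoint ones, so its adjoint is explicit, without the Riesz
    representation theorem. *)
Definition Astar x := A x /\ exists y, adj x y.

Lemma Astar_sa x : Ah x -> Astar x.
Proof. by move=> [Ax sx]; split=> //; exists x. Qed.

Lemma Astar1 : Astar 1.
Proof. by split; [exact: (csa1 AA)|exists 1; exact: adj1]. Qed.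

Lemma AstarD x y : Astar x -> Astar y -> Astar (x + y).
Proof.
move=> [Ax [x' xx]] [Ay [y' yy]]; split; first exact: (csaD AA).
by exists (x' + y'); exact: adjD.
Qed.

Lemma AstarM x y : Astar x -> Astar y -> Astar (x * y).
Proof.
move=> [Ax [x' xx]] [Ay [y' yy]]; split; first exact: (csaM AA).
by exists (y' * x'); exact: adjM.
Qed.

Lemma AstarZ (c : R) x : Astar x -> Astar (c *: x).
Proof.
move=> [Ax [x' xx]]; split; first exact: (csaZ AA).
by exists (c *: x'); exact: adjZ.
Qed.

Lemma AstarB x y : Astar x -> Astar y -> Astar (x - y).
Proof. by move=> Ax Ay; rewrite -scaleN1r; exact/AstarD/AstarZ. Qed.

Lemma rtauD x y : A x -> A y -> T (x + y) = T x + T y.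
Proof. by move=> Ax Ay; rewrite /T (tauD tau_state)// ReD. Qed.

Lemma rtauZ (c : R) x : A x -> T (c *: x) = c * T x.
Proof. by move=> Ax; rewrite /T (tauZ tau_state c%:C)// ReZ. Qed.

Lemma rtau0 : T 0 = 0.
Proof. by rewrite -(scale0r (1 : bop H)) rtauZ ?mul0r//; exact: (csa1 AA). Qed.

Lemma rtauN x : A x -> T (- x) = - T x.
Proof. by move=> Ax; rewrite -scaleN1r rtauZ// mulN1r. Qed.

Lemma rtauB x y : A x -> A y -> T (x - y) = T x - T y.
Proof. by move=> Ax Ay; rewrite rtauD ?rtauN//; exact: (csaN AA). Qed.

Lemma rtau1 : T 1 = 1.
Proof. by rewrite /T (tau1 tau_state). Qed.

Lemma rtauC x y : A x -> A y -> T (x * y) = T (y * x).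
Proof. by move=> Ax Ay; rewrite /T (tau_trace tau_state). Qed.

Lemma rtau_ge0 x y : A x -> adj x y -> 0 <= T (y * x).
Proof.
move=> Ax xy; have := tau_ge0 tau_state Ax xy.
by rewrite /T; case: (tau _) => a b; rewrite lecE/= => /andP[].
Qed.

Lemma A_cscale (c : R[i]) x : A x -> A (Defs.cscale c x).
Proof.
rewrite -(vna_bicommutant A_vna) => Ax z Az; apply: bop_ext => u.
by rewrite !bop_mulE /= bopZ -!bop_mulE Ax.
Qed.

Lemma adj_cscale_i : adj (Defs.cscale 'i 1) (Defs.cscale (- 'i) 1).
Proof.
move=> u v /=; rewrite linearZl_LR linearZr_LR /=; congr (_ * _).
by apply/eqP; rewrite eq_complex /= ?oppr0 ?opprK !eqxx.
Qed.

(** Positivity of tau on (x + i)^* (x + i) = x^* x + i x^* - i x + 1 makes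
    i (tau x^* - tau x) real. *)
Lemma rtau_adj x x' : A x -> adj x x' -> T x' = T x.
Proof.
move=> Ax xx; have Ax' := vna_adjoint A_vna Ax xx.
have A1 := csa1 AA.
have Ai c := @A_cscale c _ A1.
have := tau_ge0 tau_state (csaD AA Ax (Ai 'i)) (adjD xx adj_cscale_i).
have -> : (x' + Defs.cscale (- 'i) 1) * (x + Defs.cscale 'i 1) =
    x' * x + (Defs.cscale 'i x' + (Defs.cscale (- 'i) x + 1)).
  apply: bop_ext => u; rewrite /= !bopD !bopZ.
  rewrite scalerDr scalerA mulNr -expr2 sqr_i opprK scale1r.
  by rewrite -!addrA; congr (_ + _); rewrite addrCA.
have Axx := csaM AA Ax' Ax.
rewrite !(tauD tau_state) ?(tauZ tau_state) ?(tau1 tau_state)//;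
  do ?[exact: A1|exact: A_cscale|apply: (csaD AA)].
have := tau_ge0 tau_state Ax xx; rewrite /T.
case: (tau (x' * x)) => a b; case: (tau x) => c d; case: (tau x') => e f.
rewrite !lecE /= => /andP[/eqP b0 _] /andP[/eqP + _].
by rewrite b0; lra.
Qed.

(** The operator c - x is positive and invertible, so it is exp y = exp (y / 2)^2, the
    square of a selfadjoint element of A. *)
Lemma rtau_sa_ge0 x (c : R) : Ah x -> `|x| < c -> 0 <= c - T x.
Proof.
move=> [Ax sx] xc; have A1 := csa1 AA.
have Acx : Ah (c *: (1 : bop H) - x).
  split; first by apply: (csaB AA) => //; exact: (csaZ AA).
  by apply: adjB => //; apply: adjZ; exact: adj1.
have : bounded_below form (c *: (1 : bop H) - x).
  exists (c - `|x|) => [|u]; first by rewrite subr_gt0.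
  rewrite bop_subE bop_scaleE rformDl rformNl rformZl rform_id// mulrBl lerD2l.
  rewrite lerN2 (le_trans (rform_CS form_norm _ _))// expr2 mulrA.
  by rewrite ler_wpM2r ?hnorm_ge0// hnorm_bop.
move=> bx; have [y Ay ye] : Sigma form A (c *: (1 : bop H) - x) by apply/SigmaP.
have [Ay2 sy2] : Ah (expop (2^-1 *: y)).
  apply: sa_part_expop => //; case: Ay => Ay sy.
  by split; [exact: (csaZ AA)|exact: adjZ].
have := rtau_ge0 Ay2 sy2; rewrite -expop_half ye rtauB ?rtauZ ?rtau1 ?mulr1//.
exact: (csaZ AA).
Qed.

(** By rtau_adj, x may be replaced by its selfadjoint part. *)
Lemma rtau_norm x : Astar x -> `|T x| <= `|x|.
Proof.
move=> [Ax [x' xx]].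
have sub s : Ah s -> T s <= `|s|.
  move=> As; apply/ler_addgt0Pr => e e0.
  by rewrite -subr_ge0 rtau_sa_ge0// ltrDl.
have le y y' : A y -> adj y y' -> T y <= `|y|.
  move=> Ay yy; have Ay' := vna_adjoint A_vna Ay yy.
  have -> : T y = T (2^-1 *: (y + y')).
    rewrite rtauZ ?rtauD ?(rtau_adj Ay yy)//; first by field.
    exact: (csaD AA).
  apply: (le_trans (sub _ _)).
    split; first by apply/(csaZ AA)/(csaD AA).
    by apply: adjZ; rewrite [X in adj _ X]addrC; apply: adjD => //; exact: adj_sym.
  rewrite normrZ ger0_norm ?invr_ge0// ler_pdivrMl// mulr2n mulrDl mul1r.
  by rewrite (le_trans (ler_normD _ _))// (norm_adj form_norm yy).
rewrite ler_norml lerNl -rtauN// (le _ _ Ax xx) andbT.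
rewrite -(normrN x); apply: (le _ (- x')); first exact: (csaN AA).
exact: adjN.
Qed.

Lemma cvg_rtau {U : Type} {F : set_system U} {FF : Filter F}
    (f : U -> bop H) x : (\forall t \near F, Astar (f t)) -> Astar x ->
  f @ F --> x -> (fun t => T (f t)) @ F --> T x.
Proof.
move=> Af Ax /cvgrPdist_le fx; apply/cvgrPdist_le => e /fx.
apply: filterS2 Af => t Aft; apply: le_trans.
rewrite -rtauB; [|by case: Ax|by case: Aft].
by apply: rtau_norm; exact: AstarB.
Qed.

End Trace.

(** * The logarithm does not expand distances *)

Section LogarithmContracts.
Variables (R : realType) (H : completeNormedModType R[i]).
Variables (form : {dot H for @Num.conj R[i]}) (form_norm : hilbert_form form).
Variables (A : set (bop H)) (A_vna : von_neumann_algebra form A).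
Variables (tau : bop H -> R[i]) (tau_state : fn_tracial_state form A tau).
Implicit Types (x y z a b : bop H).
Local Notation adj := (adjoint_of form).
Local Notation Ah := (sa_part form A).
Local Notation T := (rtau tau).

Let AA : closed_subalgebra A := vna_subalgebra A_vna.

Lemma AhD x y : Ah x -> Ah y -> Ah (x + y).
Proof. by move=> [Ax sx] [Ay sy]; split; [exact: (csaD AA)|exact: adjD]. Qed.

Lemma AhZ (c : R) x : Ah x -> Ah (c *: x).
Proof. by move=> [Ax sx]; split; [exact: (csaZ AA)|exact: adjZ]. Qed.

Lemma AhN x : Ah x -> Ah (- x).
Proof. by rewrite -scaleN1r; exact: AhZ. Qed.

Lemma AhB x y : Ah x -> Ah y -> Ah (x - y).
Proof. by move=> Ax Ay; apply: AhD => //; exact: AhN. Qed.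

(** The norm of L^2(A, tau), on selfadjoint elements. *)
Definition norm2 x : R := Num.sqrt (T (x * x)).

Lemma rtau_sq_ge0 x : Ah x -> 0 <= T (x * x).
Proof. by move=> [Ax sx]; apply: (rtau_ge0 tau_state Ax sx). Qed.

Lemma norm2_sqr x : Ah x -> norm2 x ^+ 2 = T (x * x).
Proof. by move=> Ax; rewrite sqr_sqrtr// rtau_sq_ge0. Qed.

Lemma norm2_ge0 x : 0 <= norm2 x.
Proof. exact: sqrtr_ge0. Qed.

Lemma norm2N x : norm2 (- x) = norm2 x.
Proof. by rewrite /norm2 mulrNN. Qed.

Lemma rtau_sqrD x y : A x -> A y ->
  T ((x + y) * (x + y)) = T (x * x) + 2 * T (x * y) + T (y * y).
Proof.
move=> Ax Ay; have M := csaM AA; have D := csaD AA.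
rewrite mulrDl !mulrDr !(rtauD tau_state)//; do ?[apply: M|apply: D] => //.
by rewrite (rtauC tau_state Ay Ax); ring.
Qed.

(** Nonnegativity of t |-> |x + t y|^2, at its minimum, or far from 0 when y is null. *)
Lemma norm2_CS x y : Ah x -> Ah y -> T (x * y) <= norm2 x * norm2 y.
Proof.
move=> Ax Ay; have M := csaM AA.
have h (s : R) : 0 <= T (x * x) + 2 * (s * T (x * y)) + s ^+ 2 * T (y * y).
  have := rtau_sq_ge0 (AhD Ax (AhZ s Ay)).
  case: Ax => Ax _; case: Ay => Ay _.
  rewrite rtau_sqrD//; last exact: (csaZ AA).
  rewrite !bopZr !bopZl !(rtauZ tau_state) ?(mulrA s s) ?expr2//;
    do ?[exact: M|apply: (csaZ AA)].
have [Tx Ty] := (rtau_sq_ge0 Ax, rtau_sq_ge0 Ay).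
have [|t0] := leP (T (x * y)) 0.
  by move=> /le_trans; apply; rewrite mulr_ge0 ?norm2_ge0.
rewrite -(@ler_pXn2r _ 2) ?nnegrE ?(ltW t0) ?mulr_ge0 ?norm2_ge0//.
rewrite exprMn !norm2_sqr//.
move: (T (x * x)) (T (y * y)) (T (x * y)) h Tx Ty t0 => p q r h p0 q0 r0.
have [q00|q00] := eqVneq q 0.
  (* the polynomial is affine, and this point is beyond its zero *)
  have := h (- (p + 1) / (2 * r)); rewrite q00 mulr0 addr0.
  have -> : 2 * (- (p + 1) / (2 * r) * r) = - (p + 1) by field; rewrite gt_eqF.
  lra.
have qp : 0 < q by rewrite lt_neqAle eq_sym q00.
have := h (- r / q).
have -> : p + 2 * (- r / q * r) + (- r / q) ^+ 2 * q = p - r ^+ 2 / q by field.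
by rewrite subr_ge0 ler_pdivrMr.
Qed.

Lemma ler_norm2D x y : Ah x -> Ah y -> norm2 (x + y) <= norm2 x + norm2 y.
Proof.
move=> Ax Ay; rewrite -(@ler_pXn2r _ 2) ?nnegrE ?addr_ge0 ?norm2_ge0//.
rewrite norm2_sqr; last exact: AhD.
rewrite rtau_sqrD; [|by case: Ax|by case: Ay].
rewrite sqrrD !norm2_sqr// lerD2r lerD2l -[leRHS]mulr_natl.
by rewrite ler_wpM2l// norm2_CS.
Qed.

(** The squared length of the increment b - a, measured at a on one side and at b on the
    other: as b tends to a it is equivalent to the squared norm of b - a at a. *)
Definition chord a b := T ((b - a) * invop a * (b - a) * invop b).

Let A1 := csa1 AA.
Let AM := csaM AA.
Let AD := csaD AA.
Let AB := csaB AA.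

Lemma A_expop x : Ah x -> A (expop x).
Proof. by move=> [Ax _]; exact: (csa_expop AA). Qed.

Lemma chord_expop x y : Ah x -> Ah y -> chord (expop x) (expop y) =
  T (expop y * expop (- x)) + T (expop x * expop (- y)) - 2.
Proof.
move=> Ax Ay; rewrite /chord !invop_expop.
have [ex ey] := (A_expop Ax, A_expop Ay).
have [nx ny] := (A_expop (AhN Ax), A_expop (AhN Ay)).
have -> : (expop y - expop x) * expop (- x) * (expop y - expop x) * expop (- y)
    = expop y * expop (- x) + expop x * expop (- y) - (1 + 1).
  rewrite mulrBl expopN -[X in X = _]mulrA [(_ - _) * expop (- y)]mulrBl expopN.
  rewrite mulrBl mul1r mulrBr mulr1 mulrA -[_ * _ * expop x]mulrA expopNr mulr1 expopN.
  by rewrite opprB !opprD !addrA; congr (_ - _); rewrite addrAC.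
rewrite (rtauB A_vna tau_state)// ?(rtauD tau_state) ?(rtau1 tau_state)//; auto.
Qed.

(** Writing w = exp (- x / 2) exp (y / 2) and z = (w^-1)^*, the left side is
    4 (tau w + tau w^-1 - 2) and the right side is |w - z|^2 in the trace norm; their
    difference is |w + z - 2|^2, which is nonnegative. *)
Lemma chord_half x y : Ah x -> Ah y ->
  4 * chord (expop (2^-1 *: x)) (expop (2^-1 *: y)) <= chord (expop x) (expop y).
Proof.
move=> Ax Ay; have [Ax2 Ay2] := (AhZ (2^-1) Ax, AhZ (2^-1) Ay).
rewrite !chord_expop//.
have E z : expop (- z) = expop (- (2^-1 *: z)) * expop (- (2^-1 *: z)).
  by rewrite expop_half !scalerN.
rewrite (E x) (E y) (expop_half x) (expop_half y).
set p := expop (2^-1 *: x); set q := expop (2^-1 *: y).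
set p' := expop (- (2^-1 *: x)); set q' := expop (- (2^-1 *: y)).
have pp : p * p' = 1 by exact: expopN.
have qq : q * q' = 1 by exact: expopN.
have pp' : p' * p = 1 by exact: expopNr.
have qq' : q' * q = 1 by exact: expopNr.
have [[Ap sp] [Aq sq]] : Ah p /\ Ah q by split; exact: sa_part_expop.
have [[Ap' sp'] [Aq' sq']] : Ah p' /\ Ah q'.
  by split; apply: sa_part_expop => //; exact: AhN.
pose w := p' * q + p * q' - (1 + 1).
have ww : adj w (q * p' + q' * p - (1 + 1)).
  apply: adjB; last by apply: adjD; exact: adj1.
  by apply: adjD; exact: adjM.
have Aw : A w by rewrite /w; auto.
have := rtau_ge0 tau_state Aw ww.
rewrite /w mulrBl !mulrBr !mulrDr !mulrDl !mul1r !mulr1.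
have e1 : q * p' * (p * q') = 1 by rewrite mulrA -(mulrA q) pp' mulr1.
have e2 : q' * p * (p' * q) = 1 by rewrite mulrA -(mulrA q') pp mulr1.
rewrite e1 e2.
rewrite !(rtauB A_vna tau_state, rtauD tau_state); do ?[exact: A1|apply: AB|apply: AD|apply: AM] => //.
have c1 : T (q * p' * (p' * q)) = T (q * q * (p' * p')).
  by rewrite mulrA (rtauC tau_state _ Aq) ?mulrA//; do ?[apply: AM].
have c2 : T (q' * p * (p * q')) = T (p * p * (q' * q')).
  rewrite -mulrA (rtauC tau_state Aq') ?mulrA//; do ?[apply: AM] => //.
have c3 : T (q' * p) = T (p * q') by exact: (rtauC tau_state).
have c4 : T (p' * q) = T (q * p') by exact: (rtauC tau_state).
rewrite c1 c2 c3 c4 (rtau1 tau_state).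
move: (T (q * p')) (T (p * q')) (T (_ * _)) (T (_ * _)) => ? ? ? ?; lra.
Qed.

Lemma chord_pow x y n : Ah x -> Ah y ->
  chord (expop (2^-1 ^+ n *: x)) (expop (2^-1 ^+ n *: y)) <=
  (2^-1 ^+ n) ^+ 2 * chord (expop x) (expop y).
Proof.
move=> Ax Ay; elim: n => [|n IHn]; first by rewrite !expr0 expr1n !scale1r mul1r.
have := chord_half (AhZ (2^-1 ^+ n) Ax) (AhZ (2^-1 ^+ n) Ay).
rewrite !scalerA -!exprS => h.
have -> : (2^-1 ^+ n.+1) ^+ 2 = 4^-1 * (2^-1 ^+ n) ^+ 2 :> R.
  by rewrite [2^-1 ^+ n.+1]exprS exprMn; congr (_ * _); field.
by rewrite -mulrA ler_pdivlMl// (le_trans h).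
Qed.

(** Near 0 the exponential is 1 + s x to first order. *)
Lemma chord_scale_cvg x y : Ah x -> Ah y ->
  (fun s : R => (s ^+ 2)^-1 * chord (expop (s *: x)) (expop (s *: y))) @ 0^' -->
  T ((y - x) * (y - x)).
Proof.
move=> Ax Ay.
pose D (s : R) := s^-1 *: (expop (s *: y) - 1) - s^-1 *: (expop (s *: x) - 1).
have Dc : D @ 0^' --> y - x by apply: cvgB; exact: expop_deriv0.
have ec z : (fun s : R => expop (- (s *: z))) @ 0^' --> (1 : bop H).
  have : (fun s : R => - (s *: z)) @ 0^' --> - (0 *: z).
    apply: cvgN; apply: cvgZr_tmp; exact: nbhs_dnbhs.
  by rewrite scale0r oppr0 => /expop_cvg_to; rewrite expop0.
have AD' s : Astar form A (D s).
  by do ?[apply: AstarB => //|apply: AstarZ => //|exact: Astar1];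
    apply: Astar_sa; apply: sa_part_expop => //; exact: AhZ.
have Ae s z : Ah z -> Astar form A (expop (- (s *: z))).
  by move=> Az; apply: Astar_sa; apply: sa_part_expop => //; apply/AhN/AhZ.
have AE s : Astar form A (D s * expop (- (s *: x)) * D s * expop (- (s *: y))).
  by do ?[apply: AstarM => //]; exact: Ae.
have Ayx : Astar form A (y - x) by apply/Astar_sa/AhB.
have : (fun s => T (D s * expop (- (s *: x)) * D s * expop (- (s *: y)))) @ 0^'
    --> T ((y - x) * 1 * (y - x) * 1).
  apply: (cvg_rtau form_norm A_vna tau_state); first exact: nearW.
    by rewrite !mulr1; exact: AstarM.
  by do 3![apply: cvg_bopM => //].
rewrite !mulr1; apply: cvg_trans; apply: near_eq_cvg; near=> s.
have s0 : s != 0 by near: s; exact: nbhs_dnbhs_neq.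
have -> : D s = s^-1 *: (expop (s *: y) - expop (s *: x)).
  by rewrite /D -scalerBr opprB addrA subrK.
have Ee z : Ah z -> A (expop (s *: z)).
  by move=> Az; case: (sa_part_expop form_norm A_vna (AhZ s Az)).
have En z : Ah z -> A (expop (- (s *: z))) by move=> /(Ae s)[].
have AP : A ((expop (s *: y) - expop (s *: x)) * expop (- (s *: x)) *
     (expop (s *: y) - expop (s *: x)) * expop (- (s *: y))).
  apply: AM; last exact: En.
  apply: AM; last by apply: AB; exact: Ee.
  by apply: AM; [apply: AB; exact: Ee|exact: En].
rewrite /chord !invop_expop !bopZl !bopZr !bopZl !(rtauZ tau_state)//.
- by rewrite mulrA -expr2 exprVn.
- exact: (csaZ AA).
Unshelve. all: by end_near. Qed.

(** A finite form of the exponential metric increasing property.  By chord_half,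
    halving the logarithms divides the chord by at least 4; after n halvings, 4^n times
    the chord tends to the squared trace norm of y - x. *)
Lemma norm2_log_le_chord x y : Ah x -> Ah y ->
  norm2 (y - x) ^+ 2 <= chord (expop x) (expop y).
Proof.
move=> Ax Ay; rewrite norm2_sqr; last exact: AhB.
have h2 : (fun n => 2^-1 ^+ n : R) @ \oo --> (0 : R).
  by apply: cvg_expr; rewrite ger0_norm ?invr_ge0// invf_lt1// ltr1n.
have /cvgr_dnbhsP/(_ (fun n => 2^-1 ^+ n)) := chord_scale_cvg Ax Ay.
have h0 n : 2^-1 ^+ n != 0 :> R by rewrite expf_neq0.
move=> /(_ (conj h0 h2)) c.
apply: (ler_cvg_to c (cvg_cst _)); apply: nearW => n /=.
rewrite mulrC ler_pdivrMr ?exprn_gt0// ?invr_gt0//.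
by rewrite mulrC chord_pow.
Qed.

End LogarithmContracts.

(** * Right derivatives and integrals *)

Section RightDini.
Variable R : realType.

(** If G a < m < G b, the last point where G <= m lies inside the interval, and just to
    its right G is still at most m: contradiction. *)
Lemma right_dini_nonincreasing (G : R -> R) (a b : R) : a < b ->
  {within `[a, b], continuous G} ->
  (forall t, a < t < b -> \forall s \near t^'+, G s <= G t) -> G b <= G a.
Proof.
move=> ab /subspace_continuousP Gc Gd; rewrite leNgt; apply/negP => Gab.
pose m := (G a + G b) / 2.
have am : G a < m by rewrite /m; lra.
have mb : m < G b by rewrite /m; lra.
have near_in t (e : R) : `[a, b]%classic t -> 0 < e -> exists2 d, 0 < d &
    forall s, `[a, b]%classic s -> `|t - s| < d -> `|G t - G s| < e.
  move=> /Gc /cvgrPdist_lt/[apply]; rewrite near_withinE => -[d /= d0 h].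
  by exists d => // s sab ts; exact: h.
have aab : `[a, b]%classic a by rewrite /= in_itv /= lexx ltW.
have bab : `[a, b]%classic b by rewrite /= in_itv /= lexx ltW.
pose S := [set t | a <= t <= b /\ G t <= m].
have Sa : S a by rewrite /S /= lexx !ltW.
have Sub : has_ubound S by exists b => t [/andP[]].
have hS : has_sup S by split; [exists a|].
pose c := sup S.
have cab : a <= c <= b.
  apply/andP; split; first exact: ub_le_sup.
  by apply: ge_sup; [exists a|move=> t [/andP[]]].
have Gcm : G c <= m.
  rewrite leNgt; apply/negP => mc.
  have [d d0 h] := near_in c _ (cab : `[a, b]%classic c) (etrans (subr_gt0 _ _) mc).
  have [s Ss cs] := sup_adherent d0 hS.
  have sc : s <= c by exact: ub_le_sup.
  have [sab Gs] := Ss.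
  have := h s sab; rewrite -/c in cs.
  by rewrite ger0_norm ?subr_ge0// ltrBlDr -ltrBlDl => /(_ cs); rewrite ltr_norml => /andP[_]; lra.
have ca : a < c.
  have [d d0 h] := near_in a _ aab (etrans (subr_gt0 _ _) am).
  pose s := Num.min b (a + d / 2).
  have sa : a < s by rewrite lt_min ab ltrDl divr_gt0.
  have sb : s <= b by rewrite ge_min lexx.
  have sd : s <= a + d / 2 by rewrite ge_min lexx orbT.
  apply: (lt_le_trans sa); apply: ub_le_sup => //; split; first by rewrite ltW.
  have := h s; rewrite /= in_itv /= (ltW sa) sb => /(_ isT).
  rewrite ltr0_norm ?subr_lt0// opprB => h'.
  have : `|G a - G s| < m - G a by apply: h'; lra.
  by rewrite ltr_norml => /andP[]; lra.
have cb : c < b.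
  rewrite lt_neqAle; case/andP: cab => _ ->; rewrite andbT.
  by apply/eqP => cb; move: Gcm; rewrite cb leNgt mb.
have [d /= d0 h] := Gd c (introT andP (conj ca cb)).
pose s := Num.min b (c + d / 2).
have sc : c < s by rewrite lt_min cb ltrDl divr_gt0.
have sb : s <= b by rewrite ge_min lexx.
have sd : s <= c + d / 2 by rewrite ge_min lexx orbT.
have : s <= c.
  apply: ub_le_sup => //; split; first by rewrite sb (le_trans (ltW ca))// ltW.
  apply: le_trans Gcm; apply: h => //=.
  by rewrite ltr0_norm ?subr_lt0// opprB; lra.
by rewrite leNgt sc.
Qed.

(** f minus the primitive of N minus t e has right increments that are at most 0. *)
Lemma le_Rintegral_of_right_dini (f N : R -> R) :
  {within `[0, 1], continuous N} -> {within `[0, 1], continuous f} ->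
  (forall t (e : R), 0 < t < 1 -> 0 < e ->
     \forall s \near t^'+, f s - f t <= (s - t) * (N t + e)) ->
  f 1 - f 0 <= \int[lebesgue_measure]_(t in `[0, 1]) N t.
Proof.
move=> Nc fc fN.
have Ni : lebesgue_measure.-integrable `[0, 1] (EFin \o N).
  by apply: continuous_compact_integrable => //; exact: segment_compact.
pose F x := \int[lebesgue_measure]_(t in `[0, x]) N t.
have Fc : {within `[0, 1], continuous F} by exact: parameterized_integral_continuous.
have F0 : F 0 = 0 by rewrite /F set_itv1 Rintegral_set1.
rewrite -/(F 1).
apply/ler_addgt0Pr => e e0.
pose G t := f t - F t - t * e.
have ec : {within `[0, 1], continuous (fun t : R => t * e)}.
  by apply: continuous_subspaceT => t; apply: cvgM; [exact: cvg_id|exact: cvg_cst].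
have : G 1 <= G 0.
  apply: right_dini_nonincreasing => //.
    by move=> t; apply: cvgB; [apply: cvgB; [exact: fc|exact: Fc]|exact: ec].
  move=> t t01; have [t0 t1] := andP t01.
  have Ncont : {for t, continuous N}.
    have [+ _ _] := (continuous_within_itvP N ltr01).1 Nc.
    by apply; rewrite in_itv/= t0.
  have [Fd Fd'] := continuous_FTC1_closed t1 Ni t0 Ncont.
  have e2 : 0 < e / 2 by rewrite divr_gt0.
  have : (fun h : R => h^-1 *: (F (h *: 1 + t) - F t)) @ 0^' --> N t.
    by rewrite -Fd' derive1E; exact: Fd.
  move=> /cvgrPdist_le/(_ _ e2); rewrite near_withinE => -[d /= d0 dF].
  have := fN t _ t01 e2; apply: filter_app.
  have td : t < t + d by rewrite ltrDl.
  near=> s => fs.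
  have ts : t < s by near: s; exact: nbhs_right_gt.
  have sd : s < t + d by near: s; exact: nbhs_right_lt.
  have h0 : 0 < s - t by rewrite subr_gt0.
  have := dF (s - t); rewrite /= sub0r normrN gtr0_norm// ltrBlDl sd gt_eqF//.
  rewrite [_ *: 1]mulr1 subrK => /(_ isT isT).
  rewrite ler_distlC => /andP[+ _].
  rewrite -[_ *: _]/(_ * _) ler_pdivlMl// => dFs.
  by move: fs dFs; rewrite /G; move: (f s) (F s) (f t) (F t) (N t) => ? ? ? ? ?; nra.
by rewrite /G F0; lra.
Unshelve. all: by end_near. Qed.

End RightDini.

(** * Length of a smooth curve *)

Section SmoothCurves.
Variables (R : realType) (H : completeNormedModType R[i]).
Variables (form : {dot H for @Num.conj R[i]}) (form_norm : hilbert_form form).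
Variables (A : set (bop H)) (A_vna : von_neumann_algebra form A).
Variables (tau : bop H -> R[i]) (tau_state : fn_tracial_state form A tau).
Implicit Types (x y z a b : bop H) (g : R -> bop H).
Local Notation Ah := (sa_part form A).
Local Notation T := (rtau tau).

#[local] Instance at01_proper (t : R) : 0 <= t <= 1 -> ProperFilter (at01 t).
Proof.
move=> /andP[t0 t1]; apply: Build_ProperFilter_ex => P.
rewrite /at01 /within /= => -[d /= d0 h].
have d2 : 0 < d / 2 by rewrite divr_gt0.
have [t1'|t1'] := ltP t 1.
  pose s := Num.min 1 (t + d / 2); exists s.
  have ts : t < s by rewrite lt_min t1' ltrDl.
  have s1 : s <= 1 by rewrite ge_min lexx.
  have sd : s <= t + d / 2 by rewrite ge_min lexx orbT.
  apply: h; rewrite /= ?gt_eqF// ?in_itv/= ?s1 ?(le_trans t0 (ltW ts))//.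
  by rewrite ltr0_norm ?subr_lt0// opprB; lra.
pose s := Num.max 0 (t - d / 2); exists s.
have t1E : t = 1 by apply/eqP; rewrite eq_le t1 t1'.
have st : s < t by rewrite gt_max t1E ltr01/= gtrBl.
have s0 : 0 <= s by rewrite le_max lexx.
have sd : t - d / 2 <= s by rewrite le_max lexx orbT.
apply: h; rewrite /= ?lt_eqF// ?in_itv/= ?s0 ?(le_trans (ltW st) t1)//.
by rewrite gtr0_norm ?subr_gt0//; lra.
Qed.

#[local] Instance at01_filter (t : R) : Filter (at01 t).
Proof. by rewrite /at01; typeclasses eauto. Qed.

Lemma near_at01 (t : R) (P : set R) :
  (\forall s \near at01 t, P s) <->
  \forall s \near t, s != t -> 0 <= s <= 1 -> P s.
Proof.
rewrite /at01 near_withinE near_withinE.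
by split; apply: filterS => s; rewrite /= in_itv.
Qed.

Lemma at01_01 (t : R) : \forall s \near at01 t, 0 <= s <= 1.
Proof. by apply/near_at01; near=> s => _.
Unshelve. all: by end_near. Qed.

Lemma at01_neq (t : R) : \forall s \near at01 t, s != t.
Proof. by apply/near_at01; near=> s => st _.
Unshelve. all: by end_near. Qed.

Lemma invop_Sigma a : Sigma form A a ->
  [/\ a * invop a = 1, invop a * a = 1 & Ah (invop a)].
Proof.
move=> [x Ax <-]; rewrite invop_expop expopN expopNr; split=> //.
exact/(sa_part_expop form_norm A_vna)/AhN.
Qed.

(** From b^-1 = a^-1 - b^-1 (b - a) a^-1, the norm of b^-1 is at most 2 |a^-1| + 2 when b is
    close to a. *)
Lemma cvg_invop {U : Type} {F : set_system U} {FF : Filter F} (f : U -> bop H) a :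
  (\forall s \near F, Sigma form A (f s)) -> Sigma form A a ->
  f @ F --> a -> (fun s => invop (f s)) @ F --> invop a.
Proof.
move=> Sf Sa fa; have [aa' a'a _] := invop_Sigma Sa.
pose C := `|invop a| + 1; have C0 : 0 < C by rewrite ltr_wpDl.
have aC : `|invop a| <= C by rewrite lerDl.
apply/cvgrPdist_le => e e0.
have d0 : 0 < Num.min (1 / (2 * C)) (e / (2 * C ^+ 2)).
  by rewrite lt_min !divr_gt0// mulr_gt0// exprn_gt0.
move/cvgrPdist_le: fa => /(_ _ d0); apply: filterS2 Sf => s /invop_Sigma[bb' b'b _].
rewrite le_min; set b := f s => /andP[d1 d2].
have E : invop a - invop b = invop b * (b - a) * invop a.
  by rewrite mulrBr b'b mulrBl mul1r -mulrA aa' mulr1.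
have bC : `|invop b| <= 2 * C.
  have : `|invop b| <= `|invop a| + `|invop b| * (1 / (2 * C)) * C.
    rewrite -[X in `|X| <= _](subKr (invop a)).
    rewrite (le_trans (ler_normB _ _))// lerD2l E.
    rewrite (le_trans (bop_normM _ _))// ler_pM// (le_trans (bop_normM _ _))//.
    by rewrite ler_wpM2l// distrC.
  have -> : `|invop b| * (1 / (2 * C)) * C = `|invop b| / 2.
    by field; rewrite gt_eqF.
  by move: aC; move: (`|invop b|) (`|invop a|) => ? ?; lra.
rewrite E (le_trans (bop_normM _ _))//.
rewrite (@le_trans _ _ (2 * C * (e / (2 * C ^+ 2)) * C))//.
  by rewrite ler_pM// (le_trans (bop_normM _ _))// ler_pM// distrC.
by rewrite le_eqVlt; apply/orP; left; apply/eqP; field; rewrite gt_eqF.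
Qed.

Section Curve.
Variables (g : R -> bop H) (gS : smooth_curve form A g).

Lemma diff_quot_cvg t : 0 <= t <= 1 -> diff_quot g t @ at01 t --> velocity g t.
Proof. by move=> t01; exact: (sc_derivable gS t01). Qed.

Lemma curve_Ah t : 0 <= t <= 1 -> Ah (g t).
Proof. by move=> /(sc_Sigma gS) /(SigmaP form_norm A_vna)[]. Qed.

Lemma diff_quot_Ah t s : 0 <= t <= 1 -> 0 <= s <= 1 -> Ah (diff_quot g t s).
Proof. by move=> t01 s01; apply: (AhZ A_vna); apply: (AhB A_vna); exact: curve_Ah. Qed.

Lemma velocity_Ah t : 0 <= t <= 1 -> Ah (velocity g t).
Proof.
move=> t01; have PF := at01_proper t01; have c := diff_quot_cvg t01.
have near_Ah : \forall s \near at01 t, Ah (diff_quot g t s).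
  by apply: filterS (at01_01 t) => s; exact: diff_quot_Ah.
split.
  by apply: (csa_lim (vna_subalgebra A_vna) _ c); apply: filterS near_Ah => s [].
by apply: (adj_lim form_norm c c); apply: filterS near_Ah => s [].
Qed.

Lemma curve_cvg t : 0 <= t <= 1 -> g @ at01 t --> g t.
Proof.
move=> t01.
have : (fun s => g t + (s - t) *: diff_quot g t s) @ at01 t -->
    g t + (0 : R) *: velocity g t.
  apply: cvgD; first exact: cvg_cst.
  apply: cvgZ; last exact: diff_quot_cvg.
  have : (fun s : R => s - t) @ t --> t - t by apply: cvgB; [exact: cvg_id|exact: cvg_cst].
  by rewrite subrr => h; do 2![apply: cvg_within_filter]; exact: h.
rewrite scale0r addr0; apply: cvg_trans; apply: near_eq_cvg.
apply: filterS (at01_neq t) => s st.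
by rewrite /diff_quot scalerA divff ?subr_eq0// scale1r addrC subrK.
Qed.

Lemma at01_within (V : normedModType R) (f : R -> V) t :
  f @ at01 t --> f t -> f @ within `[0, 1] (nbhs t) --> f t.
Proof.
move=> /cvgrPdist_le fc; apply/cvgrPdist_le => e e0.
have /near_at01 := fc e e0; rewrite near_withinE; apply: filterS => s h s01.
have [->|st] := eqVneq s t; first by rewrite subrr normr0 ltW.
by apply: h => //; move: s01; rewrite /= in_itv.
Qed.

Lemma curve_continuous : {within `[0, 1], continuous g}.
Proof.
apply/subspace_continuousP => t; rewrite /= in_itv /= => t01.
exact/at01_within/curve_cvg.
Qed.

Lemma speed_continuous :
  {within `[0, 1], continuous (fun t => norm_at tau (g t) (velocity g t))}.
Proof.
have vc := sc_continuous gS.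
move: vc curve_continuous => /subspace_continuousP vc /subspace_continuousP gc.
apply/subspace_continuousP => t t01; have := t01; rewrite /= in_itv /= => t01'.
suff c : (fun s => ip_at tau (g s) (velocity g s) (velocity g s)) @ within `[0, 1] (nbhs t) -->
    ip_at tau (g t) (velocity g t) (velocity g t).
  by apply: continuous_cvg c; exact: sqrt_continuous.
have Sg : \forall s \near within `[0, 1] (nbhs t), Sigma form A (g s).
  rewrite near_withinE; near=> s => /=; rewrite in_itv; exact: (sc_Sigma gS).
have gt : g @ within `[0, 1] (nbhs t) --> g t by exact: gc.
have vt : velocity g @ within `[0, 1] (nbhs t) --> velocity g t by exact: vc.
have ic : (fun s => invop (g s)) @ within `[0, 1] (nbhs t) --> invop (g t).
  by apply: cvg_invop Sg _ gt; exact: (sc_Sigma gS).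
have Ast s : 0 <= s <= 1 -> Astar form A
    (velocity g s * invop (g s) * velocity g s * invop (g s)).
  move=> s01; have [_ _ Ai] := invop_Sigma (sc_Sigma gS s01).
  have Av := velocity_Ah s01.
  by do ?[apply: (AstarM A_vna)]; exact: Astar_sa.
apply: (cvg_rtau form_norm A_vna tau_state).
- by rewrite near_withinE; near=> s => /=; rewrite in_itv; exact: Ast.
- exact: Ast.
- exact: (cvg_bopM (cvg_bopM (cvg_bopM vt ic) vt) ic).
Unshelve. all: by end_near. Qed.

(** The quotient of the chord by (s - t)^2 is the trace of a product of difference
    quotients and inverses, each of which converges. *)
Lemma chord_cvg t : 0 <= t <= 1 ->
  (fun s => (`|s - t|)^-1 * Num.sqrt (chord tau (g t) (g s))) @ at01 t -->
  norm_at tau (g t) (velocity g t).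
Proof.
move=> t01; have FF := at01_filter t.
have [_ _ Ait] := invop_Sigma (sc_Sigma gS t01).
have Sg : \forall s \near at01 t, Sigma form A (g s).
  by apply: filterS (at01_01 t) => s; exact: (sc_Sigma gS).
have ic : (fun s => invop (g s)) @ at01 t --> invop (g t).
  by apply: cvg_invop Sg _ (curve_cvg t01); exact: (sc_Sigma gS).
have dc := diff_quot_cvg t01.
have Ast s : 0 <= s <= 1 -> Astar form A
    (diff_quot g t s * invop (g t) * diff_quot g t s * invop (g s)).
  move=> s01; have [_ _ Ai] := invop_Sigma (sc_Sigma gS s01).
  have Av := diff_quot_Ah t01 s01.
  by do ?[apply: (AstarM A_vna)]; exact: Astar_sa.
have c : (fun s => T (diff_quot g t s * invop (g t) * diff_quot g t s *
    invop (g s))) @ at01 t --> ip_at tau (g t) (velocity g t) (velocity g t).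
  apply: (cvg_rtau form_norm A_vna tau_state).
  - by apply: filterS (at01_01 t) => s; exact: Ast.
  - have Av := velocity_Ah t01.
    by do ?[apply: (AstarM A_vna)]; exact: Astar_sa.
  - have ct : (fun=> invop (g t)) @ at01 t --> invop (g t) by exact: cvg_cst.
    exact: (cvg_bopM (cvg_bopM (cvg_bopM dc ct) dc) ic).
have : (fun s => Num.sqrt (T (diff_quot g t s * invop (g t) * diff_quot g t s *
    invop (g s)))) @ at01 t --> norm_at tau (g t) (velocity g t).
  by apply: continuous_cvg c; exact: sqrt_continuous.
apply: cvg_trans; apply: near_eq_cvg.
apply: filterS2 (at01_neq t) (at01_01 t) => s st s01.
have AP : A ((g s - g t) * invop (g t) * (g s - g t) * invop (g s)).
  have [_ _ Ais] := invop_Sigma (sc_Sigma gS s01).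
  have Agg := AhB A_vna (curve_Ah s01) (curve_Ah t01).
  have AM := csaM (vna_subalgebra A_vna).
  by exact: (AM _ _ (AM _ _ (AM _ _ Agg.1 Ait.1) Agg.1) Ais.1).
rewrite /diff_quot !bopZl !bopZr !bopZl !(rtauZ tau_state)//; last first.
  exact: (csaZ (vna_subalgebra A_vna)).
by rewrite mulrA -expr2 sqrtrM ?sqr_ge0// sqrtr_sqr normfV.
Qed.

(** The function t |-> |log g(t) - log g(0)| grows no faster than the square root of the
    chord, hence, by chord_cvg, has right derivative at most the speed. *)
Lemma norm2_log_le_Length x y : Ah x -> Ah y -> g 0 = expop x -> g 1 = expop y ->
  norm2 tau (y - x) <= Length tau g.
Proof.
move=> Ax Ay g0 g1.
pose L t := logop form (g t).
have LE t : 0 <= t <= 1 -> Ah (L t) /\ expop (L t) = g t.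
  by move=> /(sc_Sigma gS)[z Az zg]; rewrite /L -zg (logop_expop form_norm A_vna).
have L0 : L 0 = x by rewrite /L g0 (logop_expop form_norm A_vna).
have L1 : L 1 = y by rewrite /L g1 (logop_expop form_norm A_vna).
pose f t := norm2 tau (L t - L 0).
have o01 : 0 <= (0 : R) <= 1 by rewrite lexx ler01.
have fd t s : 0 <= t <= 1 -> 0 <= s <= 1 ->
    `|f s - f t| <= Num.sqrt (chord tau (g t) (g s)).
  move=> t01 s01; have [[At eLt] [As eLs]] := (LE t t01, LE s s01).
  have [A0 _] := LE 0 o01.
  have tri a b c : Ah a -> Ah b -> Ah c ->
      norm2 tau (a - c) <= norm2 tau (a - b) + norm2 tau (b - c).
    move=> Aa Ab Ac; have -> : a - c = (a - b) + (b - c) by rewrite subrKA.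
    by apply: (ler_norm2D A_vna tau_state); exact: (AhB A_vna).
  have d : norm2 tau (L s - L t) <= Num.sqrt (chord tau (g t) (g s)).
    rewrite -(ger0_norm (norm2_ge0 tau (L s - L t))) -sqrtr_sqr ler_wsqrtr//.
    by rewrite -eLt -eLs; exact: (norm2_log_le_chord form_norm A_vna tau_state).
  apply: le_trans d; rewrite ler_distl lerBlDr; apply/andP; split.
    by rewrite -(norm2N _ (L s - L t)) opprB addrC tri.
  by rewrite addrC tri.
have fnear t (e : R) : 0 <= t <= 1 -> 0 < e -> \forall s \near at01 t,
    `|f s - f t| <= `|s - t| * (norm_at tau (g t) (velocity g t) + e).
  move=> t01 e0; have FF := at01_filter t.
  have /cvgrPdist_le/(_ e e0) := chord_cvg t01.
  apply: filterS3 (at01_neq t) (at01_01 t) => s st s01.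
  rewrite ler_distlC => /andP[_ h]; apply: (le_trans (fd t s t01 s01)).
  by rewrite -ler_pdivrMl ?normr_gt0 ?subr_eq0.
have -> : norm2 tau (y - x) = f 1 - f 0.
  by rewrite /f subrr L0 L1 /norm2 mul0r (rtau0 A_vna tau_state) sqrtr0 subr0.
apply: le_Rintegral_of_right_dini.
- exact: speed_continuous.
- apply/subspace_continuousP => t; rewrite /= in_itv /= => t01.
  apply: at01_within; have FF := at01_filter t.
  have h : (fun s : R => `|s - t| * (norm_at tau (g t) (velocity g t) + 1)) @ at01 t
      --> `|t - t| * (norm_at tau (g t) (velocity g t) + 1).
    apply: cvgM; last exact: cvg_cst.
    apply: cvg_norm; apply: cvgB; last exact: cvg_cst.
    by do 2![apply: cvg_within_filter].
  apply/cvgrPdist_le => e e0; move: h; rewrite subrr normr0 mul0r.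
  move=> /cvgr0Pnorm_le/(_ e e0); have := fnear t 1 t01 ltr01.
  apply: filterS2 => s h1 h2; rewrite distrC (le_trans h1)// (le_trans _ h2)//.
  exact: ler_norm.
move=> t e /andP[t0 t1] e0.
have t01 : 0 <= t <= 1 by rewrite !ltW.
have /near_at01 h := fnear t e t01 e0.
have {}h : \forall s \near t^'+, s != t -> 0 <= s <= 1 ->
   `|f s - f t| <= `|s - t| * (norm_at tau (g t) (velocity g t) + e).
  exact: cvg_within h.
near=> s; have ts : t < s by near: s; exact: nbhs_right_gt.
have s1 : s < 1 by near: s; exact: nbhs_right_lt.
have st : s != t by rewrite gt_eqF.
have s01 : 0 <= s <= 1 by rewrite !ltW// (lt_trans t0).
have hs : s != t -> 0 <= s <= 1 ->
   `|f s - f t| <= `|s - t| * (norm_at tau (g t) (velocity g t) + e).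
  by near: s.
by rewrite (le_trans (ler_norm _))// (le_trans (hs st s01))// gtr0_norm ?subr_gt0.
Unshelve. all: by end_near. Qed.

End Curve.

End SmoothCurves.

(** * Bounds on the distance *)

Section Derivatives.
Variables (R : realType) (H : completeNormedModType R[i]).
Implicit Types (x y z a b : bop H) (f g : R -> bop H) (t s : R).

(** The two-sided derivative, for which the product rule is stated; it restricts to the
    one-sided quotients used by velocity. *)
Definition has_velocity g t (d : bop H) := diff_quot g t @ t^' --> d.

Lemma has_velocity_cvg g t d : has_velocity g t d -> g @ t^' --> g t.
Proof.
move=> gd.
have : (fun s => g t + (s - t) *: diff_quot g t s) @ t^' --> g t + (0 : R) *: d.
  apply: cvgD; first exact: cvg_cst.
  apply: cvgZ => //.
  have : (fun s : R => s - t) @ t --> t - t by apply: cvgB; [exact: cvg_id|exact: cvg_cst].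
  by rewrite subrr => h; apply: cvg_within_filter; exact: h.
rewrite scale0r addr0; apply: cvg_trans; apply: near_eq_cvg.
near=> s; have st : s != t by near: s; exact: nbhs_dnbhs_neq.
by rewrite /diff_quot scalerA divff ?subr_eq0// scale1r addrC subrK.
Unshelve. all: by end_near. Qed.

Lemma has_velocityM f g t d e : has_velocity f t d -> has_velocity g t e ->
  has_velocity (fun s => f s * g s) t (d * g t + f t * e).
Proof.
move=> fd ge; rewrite /has_velocity.
have -> : diff_quot (fun s => f s * g s) t =
    (fun s => diff_quot f t s * g s + f t * diff_quot g t s).
  apply/funext => s; rewrite /diff_quot bopZl bopZr -scalerDr; congr (_ *: _).
  by rewrite mulrBl mulrBr addrA subrK.
apply: cvgD; apply: cvg_bopM => //; first exact: (has_velocity_cvg ge).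
exact: cvg_cst.
Qed.

Lemma has_velocity_cst a t : has_velocity (fun=> a) t 0.
Proof.
rewrite /has_velocity; have -> : diff_quot (fun=> a) t = (fun=> 0).
  by apply/funext => s; rewrite /diff_quot subrr scaler0.
exact: cvg_cst.
Qed.

Lemma has_velocity_expop x t :
  has_velocity (fun s => expop (s *: x)) t (expop (t *: x) * x).
Proof.
rewrite /has_velocity.
have -> : diff_quot (fun s => expop (s *: x)) t =
    (fun s => expop (t *: x) * ((s - t)^-1 *: (expop ((s - t) *: x) - 1))).
  apply/funext => s; rewrite /diff_quot bopZr; congr (_ *: _).
  by rewrite mulrBr mulr1 -expop_scaleD [t + _]addrC subrK.
apply: cvg_bopM; first exact: cvg_cst.
have h : (fun s : R => s - t) @ t^' --> (0 : R)^'.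
  rewrite -[X in _ --> X^'](subrr t).
  apply: continuous_injective_withinNx => [|s /addIr//].
  by apply: cvgB; [exact: cvg_id|exact: cvg_cst].
exact: (cvg_comp _ _ h (@expop_deriv0 _ _ x)).
Qed.

Lemma continuous_expop_scale x t :
  (fun s => expop (s *: x)) @ t --> expop (t *: x).
Proof. by apply: expop_cvg_to; apply: cvgZr_tmp; exact: cvg_id. Qed.

Lemma norm_expop x : `|expop x| <= expR `|x|.
Proof.
apply: ler_cvg_to (cvg_norm (@expop_cvg _ _ x)) (@expR_cvg R `|x|) _.
apply: nearW => n; rewrite /series /= (le_trans (ler_norm_sum _ _ _))//.
by apply: ler_sum => i _; exact: norm_eterm.
Qed.

End Derivatives.

Section Distance.
Variables (R : realType) (H : completeNormedModType R[i]).
Variables (form : {dot H for @Num.conj R[i]}) (form_norm : hilbert_form form).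
Variables (A : set (bop H)) (A_vna : von_neumann_algebra form A).
Variables (tau : bop H -> R[i]) (tau_state : fn_tracial_state form A tau).
Implicit Types (x y z a b v w : bop H) (g : R -> bop H).
Local Notation Ah := (sa_part form A).
Local Notation T := (rtau tau).

Lemma velocity_lim g t d : 0 <= t <= 1 ->
  diff_quot g t @ at01 t --> d -> velocity g t = d.
Proof.
by move=> t01 gd; have PF := at01_proper t01; apply: cvg_lim => //.
Qed.

Lemma smooth_curve_velocity g (g' : R -> bop H) :
  (forall t, 0 <= t <= 1 -> Sigma form A (g t)) ->
  (forall t, 0 <= t <= 1 -> diff_quot g t @ at01 t --> g' t) ->
  {within `[0, 1], continuous g'} ->
  smooth_curve form A g.
Proof.
move=> gS gg' /subspace_continuousP g'c; split => //.
  by move=> t t01; apply/cvg_ex; exists (g' t); exact: gg'.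
apply/subspace_continuousP => t t01.
have g't : g' @ within `[0, 1] (nbhs t) --> g' t by exact: g'c.
have vE s : `[0, 1]%classic s -> velocity g s = g' s.
  by rewrite /= in_itv /= => s01; apply: velocity_lim => //; exact: gg'.
suff : velocity g @ within `[0, 1] (nbhs t) --> velocity g t by [].
rewrite vE//; apply: cvg_trans g't; apply: near_eq_cvg.
by rewrite near_withinE; near=> s => s01; rewrite vE.
Unshelve. all: by end_near. Qed.

Lemma Length_ge0 g : 0 <= Length tau g.
Proof. by apply: Rintegral_ge0 => t _; exact: sqrtr_ge0. Qed.

Lemma dist_le_Length a b g : smooth_curve form A g -> g 0 = a -> g 1 = b ->
  dist form A tau a b <= Length tau g.
Proof.
move=> gS g0 g1; apply: ge_inf; last by exists g.
by exists 0 => _ [h _ <-]; exact: Length_ge0.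
Qed.

Lemma dist_ge0 a b : 0 <= dist form A tau a b.
Proof.
rewrite /dist; set S := (X in inf X).
have [->|/set0P S0] := eqVneq S set0; first by rewrite inf0.
by apply: lb_le_inf => // _ [h _ <-]; exact: Length_ge0.
Qed.

Lemma Sigma_congr x a : Ah x -> Sigma form A a ->
  Sigma form A (expop x * a * expop x).
Proof.
move=> Ax /(SigmaP form_norm A_vna)[[Aa sa] ba]; apply/(SigmaP form_norm A_vna).
have [Ae se] := sa_part_expop form_norm A_vna Ax.
have M := csaM (vna_subalgebra A_vna).
split; last by apply: (bounded_below_congr se _ ba); exact: (expopNr x).
split; first by apply: (M) => //; exact: M.
by have := adjM (adjM se sa) se; rewrite mulrA.
Qed.

Section Congruence.
Variables (x : bop H) (Ax : Ah x).
Let h := expop x.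

Lemma diff_quot_congr g t d : diff_quot g t @ at01 t --> d ->
  diff_quot (fun s => h * g s * h) t @ at01 t --> h * d * h.
Proof.
move=> gd.
have -> : diff_quot (fun s => h * g s * h) t = (fun s => h * diff_quot g t s * h).
  by apply/funext => s; rewrite /diff_quot !bopZr bopZl -mulrBl -mulrBr.
have FF := at01_filter t.
have hc : (fun=> h) @ at01 t --> h by exact: cvg_cst.
exact: (cvg_bopM (cvg_bopM hc gd) hc).
Qed.

Lemma smooth_curve_congr g : smooth_curve form A g ->
  smooth_curve form A (fun s => h * g s * h).
Proof.
move=> gS; apply: (@smooth_curve_velocity _ (fun t => h * velocity g t * h)).
- by move=> t t01; apply: Sigma_congr => //; exact: (sc_Sigma gS).
- by move=> t t01; apply: diff_quot_congr; exact: (diff_quot_cvg gS).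
have := sc_continuous gS => /subspace_continuousP vc.
apply/subspace_continuousP => t t01.
have vt : velocity g @ within `[0, 1] (nbhs t) --> velocity g t by exact: vc.
have hc : (fun=> h) @ within `[0, 1] (nbhs t) --> h by exact: cvg_cst.
exact: (cvg_bopM (cvg_bopM hc vt) hc).
Qed.

(** By invariance of the trace under conjugation: invop (h a h) = h^-1 a^-1 h^-1. *)
Lemma Length_congr g : smooth_curve form A g ->
  Length tau (fun s => h * g s * h) = Length tau g.
Proof.
move=> gS; apply: eq_Rintegral => t; rewrite inE /= in_itv /= => t01.
have hh : h * expop (- x) = 1 by exact: expopN.
have hh' : expop (- x) * h = 1 by exact: expopNr.
have [gg gg' Aig] := invop_Sigma form_norm A_vna (sc_Sigma gS t01).
have vE : velocity (fun s => h * g s * h) t = h * velocity g t * h.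
  by apply: velocity_lim => //; apply: diff_quot_congr; exact: (diff_quot_cvg gS).
have iE : invop (h * g t * h) = expop (- x) * invop (g t) * expop (- x).
  apply: invopP.
    by rewrite !mulrA -(mulrA _ h) hh mulr1 -(mulrA _ (g t)) gg mulr1 hh.
  by rewrite !mulrA -(mulrA _ (expop _) h) hh' mulr1 -(mulrA _ (invop _)) gg' mulr1 hh'.
rewrite /norm_at /ip_at vE iE; congr Num.sqrt.
set V := velocity g t; set I := invop (g t).
have -> : h * V * h * (expop (- x) * I * expop (- x)) * (h * V * h) *
    (expop (- x) * I * expop (- x)) = h * (V * I * V * I) * expop (- x).
  rewrite !mulrA -(mulrA _ h (expop _)) hh mulr1.
  rewrite -(mulrA _ (expop _) h) hh' mulr1 -(mulrA _ h (expop _)) hh mulr1.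
  by [].
have [AV _] : Ah V by exact: (velocity_Ah form_norm A_vna gS).
have [[Ah1 _] [Ah2 _]] : Ah h /\ Ah (expop (- x)).
  by split; apply: (sa_part_expop form_norm A_vna) => //; exact: (AhN A_vna).
have M := csaM (vna_subalgebra A_vna).
rewrite -/(T _) (rtauC tau_state _ Ah2).
  by rewrite !mulrA hh' mul1r.
exact: (M _ _ Ah1 (M _ _ (M _ _ (M _ _ AV Aig.1) AV) Aig.1)).
Qed.

Lemma dist_congr_le a b :
  (exists g, [/\ smooth_curve form A g, g 0 = a & g 1 = b]) ->
  dist form A tau (h * a * h) (h * b * h) <= dist form A tau a b.
Proof.
move=> ex; apply: lb_le_inf; first by case: ex => g gab; exists (Length tau g); exists g.
move=> _ [g [gS g0 g1] <-]; rewrite -Length_congr//.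
by apply: dist_le_Length; rewrite ?g0 ?g1//; exact: smooth_curve_congr.
Qed.

End Congruence.

Section UpperBound.
Variables (v w : bop H) (Av : Ah v) (Aw : Ah w).

Let P (s : R) : bop H := expop (s *: (2^-1 *: w)).
Let Q (s : R) : bop H := expop v * expop (s *: - v).
Let k : bop H := 2^-1 *: w.
Let g (s : R) : bop H := P s * Q s * P s.
Let g' (s : R) : bop H := (P s * k * Q s + P s * (expop v * (expop (s *: - v) * - v))) * P s +
   P s * Q s * (P s * k).

Let AM := csaM (vna_subalgebra A_vna).
Let AD := csaD (vna_subalgebra A_vna).
Let AN := csaN (vna_subalgebra A_vna).

Let Ak : Ah k. Proof. exact: (AhZ A_vna). Qed.

Let QE s : Q s = expop ((1 - s) *: v).
Proof. by rewrite /Q scalerBl scale1r expopD -?scalerN// /GRing.comm bopZr bopZl mulrN mulNr. Qed.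

Let g_Sigma s : Sigma form A (g s).
Proof.
apply: Sigma_congr; first exact: (AhZ A_vna).
by rewrite QE; exists ((1 - s) *: v) => //; exact: (AhZ A_vna).
Qed.

Let g_velocity s : has_velocity g s (g' s).
Proof.
have Pd := @has_velocity_expop _ _ k s.
have Qd : has_velocity Q s (expop v * (expop (s *: - v) * - v)).
  have := has_velocityM (@has_velocity_cst _ _ (expop v) s) (@has_velocity_expop _ _ (- v) s).
  by rewrite mul0r add0r.
exact: (has_velocityM (has_velocityM Pd Qd) Pd).
Qed.

Let g'_continuous (s : R) : g' @ s --> g' s.
Proof.
have Pc : P @ s --> P s by exact: continuous_expop_scale.
have c a : (fun=> a) @ s --> (a : bop H) by exact: cvg_cst.
have Rc : (fun t => expop (t *: - v)) @ s --> expop (s *: - v).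
  exact: continuous_expop_scale.
have Qc : Q @ s --> Q s by exact: (cvg_bopM (c _) Rc).
have Pkc : (fun t => P t * k) @ s --> P s * k by exact: (cvg_bopM Pc (c k)).
have Rvc : (fun t => expop v * (expop (t *: - v) * - v)) @ s -->
    expop v * (expop (s *: - v) * - v).
  exact: (cvg_bopM (c (expop v)) (cvg_bopM Rc (c (- v)))).
apply: cvgD; last exact: (cvg_bopM (cvg_bopM Pc Qc) Pkc).
apply: (cvg_bopM _ Pc); apply: cvgD; first exact: (cvg_bopM Pkc Qc).
exact: (cvg_bopM Pc Rvc).
Qed.

Let at01_velocity t : diff_quot g t @ at01 t --> g' t.
Proof. by apply: cvg_within_filter; exact: g_velocity. Qed.

Let g_smooth : smooth_curve form A g.
Proof.
apply: (@smooth_curve_velocity _ g') => //.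
apply: continuous_subspaceT => s; exact: g'_continuous.
Qed.

Let g0 : g 0 = expop v.
Proof. by rewrite /g QE subr0 scale1r /P scale0r expop0 mul1r mulr1. Qed.

Let g1 : g 1 = expop w.
Proof. by rewrite /g QE subrr scale0r expop0 mulr1 /P scale1r [RHS]expop_half. Qed.

(** With c = P Q P, P = exp (t k), k = w / 2 and Q = exp ((1 - t) v), one has
    c' c^-1 = P (k + Q k Q^-1 - v) P^-1, because P commutes with k and Q with v.  The trace
    of its square is |v|^2 - 4 tau (v k) plus terms quadratic in k. *)
Let speed2 t : 0 <= t <= 1 -> ip_at tau (g t) (velocity g t) (velocity g t) <=
  T (v * v) - 2 * T (v * w) + 2^-1 * (1 + expR `|v| ^+ 2) * `|w| ^+ 2.
Proof.
move=> t01; rewrite (velocity_lim t01 (@at01_velocity t)).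
pose q := expop ((1 - t) *: v); pose q' := expop (- ((1 - t) *: v)).
pose p := P t; pose p' := expop (- (t *: k)).
have pp : p * p' = 1 by exact: expopN.
have pp' : p' * p = 1 by exact: expopNr.
have qq : q * q' = 1 by exact: expopN.
have qq' : q' * q = 1 by exact: expopNr.
have iE : invop (g t) = p' * q' * p'.
  rewrite /g QE -/q -/p; apply: invopP.
    by rewrite !mulrA -(mulrA _ p) pp mulr1 -(mulrA _ q) qq mulr1 pp.
  by rewrite !mulrA -(mulrA _ p' p) pp' mulr1 -(mulrA _ q' q) qq' mulr1 pp'.
pose k' := q * k * q'; pose Y := k + (k' - v).
have pk : p * k = k * p by symmetry; apply: comm_expop; rewrite /GRing.comm bopZr bopZl.
have qv : q * v = v * q by symmetry; apply: comm_expop; rewrite /GRing.comm bopZr bopZl.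
have VE : g' t * invop (g t) = p * Y * p'.
  have E1 : expop v * (expop (t *: - v) * - v) = - (v * q).
    by rewrite mulrA -/(Q t) QE mulrN qv.
  have E2 : (p * k * q + p * - (v * q)) * p * (p' * q' * p') =
      p * k * p' - p * v * p'.
    rewrite !mulrA -(mulrA _ p p') pp mulr1 !mulrDl mulrN !mulNr !mulrA.
    by rewrite -!(mulrA _ q q') qq !mulr1.
  have E3 : p * q * (p * k) * (p' * q' * p') = p * k' * p'.
    by rewrite pk !mulrA -(mulrA _ p p') pp mulr1.
  rewrite iE /g' E1 QE -/q -/p mulrDl E2 E3 /Y !mulrDr !mulrDl mulrN mulNr.
  by rewrite -addrA; congr (_ + _); rewrite addrC.
have [[Ap _] [Ap' _]] : Ah p /\ Ah p'.
  have Atk : Ah (t *: k) by exact: (AhZ A_vna).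
  by split; apply: (sa_part_expop form_norm A_vna) => //; exact: (AhN A_vna).
have [[Aq sq] [Aq' sq']] : Ah q /\ Ah q'.
  have Atv : Ah ((1 - t) *: v) by exact: (AhZ A_vna).
  by split; apply: (sa_part_expop form_norm A_vna) => //; exact: (AhN A_vna).
have [Akk sk] := Ak; have [Avv sv] := Av; have [Aww _] := Aw.
have Ak' : A k' by exact: (AM (AM Aq Akk) Aq').
have AD' : A (k' - v) by exact: (csaB (vna_subalgebra A_vna)).
have AY : A Y by exact: AD.
have ipE : ip_at tau (g t) (g' t) (g' t) = T (Y * Y).
  have -> : ip_at tau (g t) (g' t) (g' t) = T (p * (Y * Y) * p').
    rewrite /ip_at -mulrA VE -/(T _); congr T.
    by rewrite !mulrA -(mulrA _ p' p) pp' mulr1.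
  rewrite (rtauC tau_state _ Ap'); last exact: (AM Ap (AM AY AY)).
  by rewrite mulrA pp' mul1r.
have conj z z' : A z -> A z' -> z' * q' = q' * z' -> T (q * z * q' * z') = T (z * z').
  move=> Az Az' zq; rewrite -(mulrA _ q') -zq -!mulrA.
  rewrite (rtauC tau_state Aq); last exact: (AM Az (AM Az' Aq')).
  by rewrite -!mulrA qq' mulr1.
have q'v : v * q' = q' * v.
  by apply: comm_expop; rewrite /GRing.comm mulrN mulNr bopZr bopZl.
rewrite ipE.
have e1 : T (k' * v) = T (k * v) by exact: conj.
have e2 : T (k' * k') = T (k * k).
  rewrite /k' !mulrA -(mulrA _ q' q) qq' mulr1 -(mulrA q k k).
  have := conj (k * k) 1 (AM Akk Akk) (csa1 (vna_subalgebra A_vna)).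
  by rewrite !mulr1 mul1r; apply.
have e3 : T (k * k') <= `|k| ^+ 2 * expR `|v| ^+ 2.
  have Akk' : Astar form A (k * k').
    by do ![apply: (AstarM A_vna)|exact: Astar_sa]; apply: Astar_sa.
  apply: (le_trans (ler_norm _)); apply: (le_trans (rtau_norm form_norm A_vna tau_state Akk')).
  have nq : `|q| <= expR `|v| /\ `|q'| <= expR `|v|.
    have h : `|(1 - t) *: v| <= `|v|.
      have /andP[t0 t1] := t01.
      by rewrite normrZ ler_piMl// ger0_norm ?subr_ge0// gerBl.
    by split; apply: (le_trans (norm_expop _)); rewrite ler_expR// normrN.
  have [n1 n2] := nq.
  rewrite /k' !mulrA; apply: (le_trans (bop_normM _ _)).
  apply: ler_pM => //.
  apply: (le_trans (bop_normM _ _)); rewrite expr2 mulrAC; apply: ler_pM => //.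
  by apply: (le_trans (bop_normM _ _)); apply: ler_pM.
have e4 : T (k * k) <= `|k| ^+ 2.
  have Akk' : Astar form A (k * k) by apply: (AstarM A_vna); exact: Astar_sa.
  apply: (le_trans (ler_norm _)); apply: (le_trans (rtau_norm form_norm A_vna tau_state Akk')).
  by rewrite expr2 bop_normM.
have e5 : T (k * v) = 2^-1 * T (v * w).
  by rewrite /k bopZl (rtauZ tau_state) ?(rtauC tau_state Aww Avv)//; exact: AM.
have e6 : `|k| ^+ 2 = 4^-1 * `|w| ^+ 2.
  by rewrite /k normrZ gtr0_norm// exprMn; congr (_ * _); field.
have -> : T (Y * Y) = T (v * v) + 2 * T (k * k) + 2 * T (k * k') - 4 * T (k * v).
  have AvN : A (- v) by exact: AN.
  rewrite /Y !(rtau_sqrD A_vna tau_state)// mulrBr mulrNN mulrN.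
  rewrite (rtauB A_vna tau_state) ?(rtauN tau_state)//; do ?[exact: AM].
  by rewrite e1 e2; ring.
rewrite e5; move: e3 e4; rewrite e6.
move: (expR _ ^+ 2) (`|w| ^+ 2) (T (k * k')) (T (k * k)) (T (v * v)) (T (v * w)) => E W a b c d.
nra.
Qed.

Lemma smooth_curve_joining_expop :
  exists h, [/\ smooth_curve form A h, h 0 = expop v & h 1 = expop w].
Proof. by exists g. Qed.

(** The length of the curve exp (t w / 2) exp ((1 - t) v) exp (t w / 2), to first order in
    w.  With w = 0 it is the geodesic from exp v to 1, of length |v|. *)
Lemma dist_expop_le : dist form A tau (expop v) (expop w) <=
  Num.sqrt (T (v * v) - 2 * T (v * w) +
            2^-1 * (1 + expR `|v| ^+ 2) * `|w| ^+ 2).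
Proof.
apply: (le_trans (dist_le_Length g_smooth g0 g1)); rewrite /Length.
set B := Num.sqrt _.
have m01 : measurable (`[0, 1]%classic : set R) by exact: measurable_itv.
have Bi : lebesgue_measure.-integrable `[0, 1] (EFin \o cst B).
  apply: continuous_compact_integrable; first exact: segment_compact.
  by apply: continuous_subspaceT => t; exact: cvg_cst.
have -> : B = \int[lebesgue_measure]_(t in `[0, 1]) cst B t.
  rewrite Rintegral_cst//= lebesgue_measure_itv /= lte_fin ltr01 /=.
  by rewrite subr0 mulr1.
apply: le_Rintegral => //.
  apply: continuous_compact_integrable; first exact: segment_compact.
  exact: (speed_continuous form_norm A_vna tau_state g_smooth).
by move=> t; rewrite /= in_itv /= => t01; rewrite /norm_at ler_wsqrtr// speed2.
Qed.

End UpperBound.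

Lemma norm2_sub_le_dist v w : Ah v -> Ah w ->
  norm2 tau (w - v) <= dist form A tau (expop v) (expop w).
Proof.
move=> Av Aw; apply: lb_le_inf.
  have [g gvw] := smooth_curve_joining_expop Av Aw.
  by exists (Length tau g); exists g.
by move=> _ [g [gS g0 g1] <-]; exact: (norm2_log_le_Length form_norm A_vna tau_state gS).
Qed.

Lemma dist_congr x a b : Ah x -> Sigma form A a -> Sigma form A b ->
  dist form A tau (expop x * a * expop x) (expop x * b * expop x) =
  dist form A tau a b.
Proof.
move=> Ax Sa Sb.
have join c d : Sigma form A c -> Sigma form A d ->
    exists g, [/\ smooth_curve form A g, g 0 = c & g 1 = d].
  by move=> [v Av <-] [w Aw <-]; exact: smooth_curve_joining_expop.
apply/eqP; rewrite eq_le dist_congr_le//; last exact: join.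
have K c : expop (- x) * (expop x * c * expop x) * expop (- x) = c.
  by rewrite !mulrA expopNr mul1r -mulrA expopN mulr1.
rewrite -{1}(K a) -{1}(K b) dist_congr_le//; first exact: (AhN A_vna).
by apply: join; exact: Sigma_congr.
Qed.

End Distance.

(** * Convex exponential sets *)

Section ConvexExponentialSet.
Variables (R : realType) (H : completeNormedModType R[i]).
Variables (form : {dot H for @Num.conj R[i]}) (form_norm : hilbert_form form).
Variables (A : set (bop H)) (A_vna : von_neumann_algebra form A).
Variables (tau : bop H -> R[i]) (tau_state : fn_tracial_state form A tau).
Variables (W : set (bop H)) (W_sub : closed_real_subspace form A W).
Hypothesis W_convex : convex_subset form (@expop R H @` W).
Implicit Types (x y z v w r : bop H).
Local Notation Ah := (sa_part form A).
Local Notation T := (rtau tau).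

Let W_Ah w : W w -> Ah w. Proof. exact: (crs_sub W_sub). Qed.

Let WN w : W w -> W (- w).
Proof. by move=> Ww; rewrite -scaleN1r; exact: (crsZ W_sub). Qed.

(** The reflection of exp (- w) in exp w0, that is p q^-1 p for q = exp (- w), is the
    point of parameter -1 of the geodesic from p to q. *)
Lemma exponential_set_congr w0 w : W w0 -> W w ->
  exists2 z, W z & expop w0 * expop w * expop w0 = expop z.
Proof.
move=> W0 Ww; have [A0 Aw] := (W_Ah W0, W_Ah Ww).
have M0 : (@expop R H @` W) (expop w0) by exists w0.
have MN : (@expop R H @` W) (expop (- w)) by exists (- w) => //; exact: WN.
have [z Wz ez] := W_convex M0 MN (-1); exists z => //.
rewrite ez /geodesic !(powop_expop form_norm A_vna)//.
have Ah2 : Ah ((- 2^-1) *: w0) by exact: (AhZ A_vna).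
have [y Ay yE] : Sigma form A
    (expop (- 2^-1 *: w0) * expop (- w) * expop (- 2^-1 *: w0)).
  by apply: (Sigma_congr form_norm A_vna) => //; exists (- w) => //; exact: (AhN A_vna).
rewrite -yE (powop_expop form_norm A_vna)// scaleN1r -invop_expop yE.
have E1 : expop (- 2^-1 *: w0) * expop (2^-1 *: w0) = 1.
  by rewrite scaleNr expopNr.
have E2 : expop (2^-1 *: w0) * expop (- 2^-1 *: w0) = 1.
  by rewrite scaleNr expopN.
rewrite (@invopP _ _ _ (expop (2^-1 *: w0) * expop w * expop (2^-1 *: w0))).
- by rewrite {1 2}(expop_half w0) !mulrA.
- by rewrite !mulrA -(mulrA _ (expop (- 2^-1 *: w0)) (expop (2^-1 *: w0))) E1 mulr1
    -(mulrA _ (expop (- w))) expopNr mulr1 E1.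
by rewrite !mulrA -(mulrA _ (expop (2^-1 *: w0)) (expop (- 2^-1 *: w0))) E2 mulr1
  -(mulrA _ (expop w)) expopN mulr1 E2.
Qed.

Section BasePoint.
Variables (w0 : bop H) (W0 : W w0).
Let h := expop (2^-1 *: w0).
Let g := expop (- (2^-1 *: w0)).

Let A0 : Ah (2^-1 *: w0). Proof. exact/(AhZ A_vna)/W_Ah. Qed.
Let A0N : Ah (- (2^-1 *: w0)). Proof. exact: (AhN A_vna). Qed.
Let gh : g * h = 1. Proof. exact: expopNr. Qed.
Let hg : h * g = 1. Proof. exact: expopN. Qed.

Let sandwichK x : g * (h * x * h) * g = x.
Proof. by rewrite !mulrA gh mul1r -mulrA hg mulr1. Qed.

Let sandwichKV x : h * (g * x * g) * h = x.
Proof. by rewrite !mulrA hg mul1r -mulrA gh mulr1. Qed.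

Let base : expop w0 = h * 1 * h. Proof. by rewrite mulr1 expop_half. Qed.

Let invop_base : invop (expop w0) = g * g.
Proof. by rewrite invop_expop expop_half scalerN. Qed.

Let powop_base : powop form (expop w0) (2^-1) = h.
Proof. by rewrite (powop_expop form_norm A_vna)//; exact: W_Ah. Qed.

Let powopN_base : powop form (expop w0) (- 2^-1) = g.
Proof. by rewrite (powop_expop form_norm A_vna) ?scaleNr//; exact: W_Ah. Qed.

Let Wh : W (2^-1 *: w0). Proof. exact: (crsZ W_sub). Qed.

Let sandwich_Ah x : Ah x -> Ah (h * x * h).
Proof.
move=> [Ax sx]; have [Ae se] := sa_part_expop form_norm A_vna A0.
have M := csaM (vna_subalgebra A_vna).
split; first exact: (M _ _ (M _ _ Ae Ax) Ae).
by have := adjM (adjM se sx) se; rewrite mulrA.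
Qed.

Let ip_tangent x w : Ah x -> Ah w ->
  ip_at tau (expop w0) (h * x * h) (h * w * h) = T (x * w).
Proof.
move=> [Ax _] [Aw _]; rewrite /ip_at invop_base.
have -> : h * x * h * (g * g) * (h * w * h) * (g * g) = h * (x * w) * g.
  rewrite !mulrA -(mulrA _ h g) hg mulr1 -(mulrA _ g h) gh mulr1.
  by rewrite -(mulrA _ h g) hg mulr1.
have M := csaM (vna_subalgebra A_vna).
have [Ag _] := sa_part_expop form_norm A_vna A0N.
have [Ae _] := sa_part_expop form_norm A_vna A0.
rewrite -/(T _) (rtauC tau_state (M _ _ Ae (M _ _ Ax Aw)) Ag).
by rewrite mulrA gh mul1r.
Qed.

Lemma dist_base v w : Ah v -> Ah w ->
  dist form A tau (h * expop v * h) (h * expop w * h) =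
  dist form A tau (expop v) (expop w).
Proof.
by move=> Av Aw; apply: (dist_congr form_norm A_vna tau_state A0); [exists v|exists w].
Qed.

(** Moving p = exp w0 to 1, the distance from exp v to exp z is at least |v - z|, which by
    Pythagoras is at least |v|, the distance from exp v to 1. *)
Lemma orthogonal_nearest v : Ah v -> (forall w, W w -> T (v * w) = 0) ->
  forall w, W w ->
  dist form A tau (h * expop v * h) (expop w0) <=
  dist form A tau (h * expop v * h) (expop w).
Proof.
move=> Av vW w Ww.
have [z Wz zE] := exponential_set_congr (WN Wh) Ww.
have Az := W_Ah Wz.
have -> : expop w = h * expop z * h by rewrite -zE sandwichKV.
have A00 : Ah 0 by exact: (W_Ah (crs0 W_sub)).
rewrite base -(@expop0 R H) !dist_base//.
apply: le_trans (norm2_sub_le_dist form_norm A_vna tau_state Av Az).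
rewrite (le_trans (dist_expop_le form_norm A_vna tau_state Av A00))//.
rewrite mulr0 (rtau0 A_vna tau_state) mulr0 subr0 normr0 expr0n mulr0 addr0.
rewrite ler_wsqrtr//.
have [[AAv _] [AAz _]] := (Av, Az).
have -> : z - v = - v + z by rewrite addrC.
rewrite (rtau_sqrD A_vna tau_state)//; last exact: (csaN (vna_subalgebra A_vna)).
rewrite mulrNN mulNr (rtauN tau_state); last exact: (csaM (vna_subalgebra A_vna)).
by rewrite (vW _ Wz) oppr0 mulr0 addr0 lerDl (rtau_sq_ge0 tau_state).
Qed.

(** First variation: along exp (t w) the squared distance to exp v is at most
    |v|^2 - 2 t tau (v w) + K t^2, and at t = 0 it is |v|^2; minimality makes the linear
    coefficient vanish. *)
Lemma nearest_orthogonal v : Ah v ->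
  (forall w, W w -> dist form A tau (h * expop v * h) (expop w0) <=
                    dist form A tau (h * expop v * h) (expop w)) ->
  forall w, W w -> T (v * w) = 0.
Proof.
move=> Av vmin w Ww.
have A00 : Ah 0 by exact: (W_Ah (crs0 W_sub)).
have Aw := W_Ah Ww.
have [[AAv _] [AAw _]] := (Av, Aw).
pose K := 2^-1 * (1 + expR `|v| ^+ 2) * `|w| ^+ 2.
have E1 : 1 <= expR `|v| ^+ 2.
  by rewrite -(expr1n _ 2) lerXn2r ?nnegrE ?expR_ge0// (le_trans _ (expR_ge1Dx _))// lerDl.
have M := csaM (vna_subalgebra A_vna).
have ineq (t : R) : 0 <= - 2 * (t * T (v * w)) + t ^+ 2 * K.
  have Wt : W (t *: w) by exact: (crsZ W_sub).
  have At := W_Ah Wt.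
  have [z Wz zE] := exponential_set_congr Wh Wt.
  have := vmin z Wz; rewrite -zE -/h base -(@expop0 R H) !dist_base// => h1.
  have h2 := norm2_sub_le_dist form_norm A_vna tau_state Av A00.
  have h3 := dist_expop_le form_norm A_vna tau_state Av At.
  have := le_trans h2 (le_trans h1 h3).
  rewrite sub0r norm2N /norm2.
  have B0 : 0 <= T (v * v) - 2 * T (v * (t *: w)) +
      2^-1 * (1 + expR `|v| ^+ 2) * `|t *: w| ^+ 2.
    have Avt : Ah (v - t *: w) by exact: (AhB A_vna).
    have := rtau_sq_ge0 tau_state Avt.
    rewrite (rtau_sqrD A_vna tau_state)//; last first.
      by apply: (csaN (vna_subalgebra A_vna)); case: At.
    rewrite mulrN mulrNN (rtauN tau_state); last by apply: M => //; case: At.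
    have : T (t *: w * (t *: w)) <= `|t *: w| ^+ 2.
      have At2 : Astar form A (t *: w * (t *: w)) by apply: (AstarM A_vna); exact: Astar_sa.
      apply: (le_trans (ler_norm _)).
      apply: (le_trans (rtau_norm form_norm A_vna tau_state At2)).
      by rewrite expr2 bop_normM.
    have := sqr_ge0 `|t *: w|; move: E1.
    move: (expR _ ^+ 2) (`|t *: w| ^+ 2) (T (_ * _)) (T (_ * _)) (T (_ * _)) => E n a b c.
    nra.
  rewrite ler_sqrt// bopZr (rtauZ tau_state); last exact: M.
  rewrite normrZ exprMn real_normK ?num_real//.
  by rewrite /K; move: (T _) (T _) (expR _) (`|w| ^+ 2) => ? ? ? ?; lra.
move: ineq; move: (T (v * w)) K => a k ineq.
have [//|a0] := eqVneq a 0.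
have [k0|k0] := leP k 0.
  have := ineq a; have : 0 < a ^+ 2 by rewrite exprn_even_gt0.
  nra.
(* t = a / k is where the parabola - 2 t a + t^2 k is lowest *)
have := ineq (a / k).
have -> : - 2 * (a / k * a) + (a / k) ^+ 2 * k = - (a ^+ 2 / k) by field; rewrite gt_eqF.
by rewrite oppr_ge0 leNgt divr_gt0// exprn_even_gt0.
Qed.

Lemma base_orthogonal_geodesic v : Ah v -> (forall w, W w -> T (v * w) = 0) ->
  orthogonal_geodesic form A tau W (h * expop v * h).
Proof.
move=> Av vW; exists (expop w0), (h * v * h); split.
- by exists w0.
- exact: sandwich_Ah.
- move=> _ [w Ww <-]; rewrite powop_base ip_tangent ?vW//; exact: W_Ah.
- by rewrite /Exp powop_base powopN_base sandwichK.
Qed.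

Lemma orthogonal_geodesic_base r u : Ah u ->
  (forall w, tangent form W (expop w0) w -> ip_at tau (expop w0) u w = 0) ->
  Exp form (expop w0) u = r ->
  exists2 v, Ah v & (forall w, W w -> T (v * w) = 0) /\ r = h * expop v * h.
Proof.
move=> Au uW ur; have [AAu su] := Au.
have [Ae se] := sa_part_expop form_norm A_vna A0N.
have M := csaM (vna_subalgebra A_vna).
have Ahu : Ah (g * u * g).
  split; first exact: (M _ _ (M _ _ Ae AAu) Ae).
  by have := adjM (adjM se su) se; rewrite mulrA.
exists (g * u * g) => //; split=> [w Ww|]; last first.
  by rewrite -ur /Exp powop_base powopN_base.
rewrite -ip_tangent ?sandwichKV//; last exact: W_Ah.
by apply: uW; rewrite -powop_base; exists w.
Qed.

End BasePoint.

(** Every r is the end point of a geodesic issued from p = exp w0. *)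
Lemma Sigma_base w0 r : W w0 -> Sigma form A r ->
  exists2 v, Ah v & r = expop (2^-1 *: w0) * expop v * expop (2^-1 *: w0).
Proof.
move=> W0 Sr; have A0 : Ah (- (2^-1 *: w0)) by exact/(AhN A_vna)/(AhZ A_vna)/W_Ah.
have [v Av vE] := Sigma_congr form_norm A_vna A0 Sr.
exists v => //; rewrite vE.
by rewrite !mulrA expopN mul1r -mulrA expopNr mulr1.
Qed.

Lemma dist_set_le r w : W w ->
  dist_set form A tau r (@expop R H @` W) <= dist form A tau r (expop w).
Proof.
move=> Ww; apply: ge_inf; last by exists (expop w) => //; exists w.
by exists 0 => _ [q _ <-]; exact: dist_ge0.
Qed.

End ConvexExponentialSet.

Theorem lemma5p3 (R : realType) (H : completeNormedModType R[i])
    (form : {dot H for @Num.conj R[i]}) (form_norm : hilbert_form form)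
    (A : set (bop H)) (A_vna : von_neumann_algebra form A)
    (tau : bop H -> R[i]) (tau_state : fn_tracial_state form A tau)
    (r : bop H) (r_Sigma : Sigma form A r)
    (W : set (bop H)) (W_sub : closed_real_subspace form A W)
    (M : set (bop H)) (M_exp : M = @expop R H @` W)
    (M_convex : convex_subset form M) :
  (exists p, M p /\ dist_set form A tau r M = dist form A tau r p) <->
  orthogonal_geodesic form A tau W r.
Proof.
subst M; split.
  move=> [_ [[w0 W0 <-] dE]].
  have [v Av rE] := Sigma_base form_norm A_vna W_sub W0 r_Sigma.
  have vW : forall w, W w -> rtau tau (v * w) = 0.
    apply: (nearest_orthogonal form_norm A_vna tau_state W_sub M_convex W0 Av).
    by move=> w Ww; rewrite -rE -dE; exact: dist_set_le.
  by rewrite rE; apply: base_orthogonal_geodesic.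
move=> [_ [u [[w0 W0 <-] Au uW ur]]].
have [v Av [vW rE]] :=
  orthogonal_geodesic_base form_norm A_vna tau_state W_sub W0 Au uW ur.
exists (expop w0); split; first by exists w0.
apply/eqP; rewrite eq_le dist_set_le//=; apply: lb_le_inf.
  by exists (dist form A tau r (expop w0)), (expop w0) => //; exists w0.
move=> _ [_ [w Ww <-] <-]; rewrite rE.
exact: (orthogonal_nearest form_norm A_vna tau_state W_sub M_convex W0 Av vW Ww).
Qed.
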